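(* Let $k$ be a field of characteristic not $2$ with separable closure $k^s$, $n$ even, $G=\mathrm{SL}_n$ and $H=\mathrm{SL}_n/\mu_2$ acting on $V=\mathrm{Sym}_2(k^n)^*\oplus\mathrm{Sym}_2(k^n)^*$. Let $f(x,y)=f_0x^n+\cdots+f_ny^n$ be a binary form over $k$ with $\Delta(f)\neq0$ and $f_0\neq0$; write $f(x,1)=f_0g(x)$ with $g$ monic and $L=k[x]/(g)$. Then the stabilizer group schemes $G_f$ and $H_f$ are $(\mathrm{Res}_{L/k}\mu_2)_{N=1}$ and $(\mathrm{Res}_{L/k}\mu_2)_{N=1}/\mu_2$ respectively. Let $\delta_0:H^1(k,\mu_2)=k^\times/k^{\times2}\to H^2(k,G_f)$ be the connecting homomorphism of the exact sequence $1\to(\mathrm{Res}_{L/k}\mu_2)_{N=1}\to\mathrm{Res}_{L/k}\mu_2\xrightarrow{N}\mu_2\to1$. Then the obstruction class $d_f^G\in H^2(k,G_f)$ equals $\delta_0(f_0)$ (the image of the class of $f_0$), and the natural map $H^2(k,G_f)\to H^2(k,H_f)$ sends $d_f^G$ to $d_f^H$.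
   Context: $G$ acts on pairs $(A,B)$ of symmetric bilinear forms on $k^n$ by $(g\cdot A)(w,w')=A(gw,gw')$; the invariant binary form of $(A,B)$ is $\mathrm{disc}(xA-yB)$, where $\mathrm{disc}(A)=(-1)^{n(n-1)/2}\det(A)$ computed in a basis of determinant $1$; $V_f$ is the set of vectors with invariant $f$; $\Delta(f)=\prod_{i<j}(\alpha_i\beta_j-\alpha_j\beta_i)^2$ for $f=\prod(\alpha_ix-\beta_iy)$. For $\mathcal G\in\{G,H\}$: $\mathcal G(k^s)$ acts transitively on $V_f(k^s)$ with abelian stabilizers. For $v\in V_f(k^s)$ choose $g_\sigma\in\mathcal G(k^s)$ with $g_\sigma\,{}^\sigma v=v$; conjugation by $g_\sigma$ gives choice-independent descent data on $\mathcal G_v$, yielding the $k$-group scheme $\mathcal G_f$ with isomorphisms $\iota_v:\mathcal G_f(k^s)\to\mathcal G_v$. The obstruction class $d_f^{\mathcal G}\in H^2(k,\mathcal G_f)$ is the class of the $2$-cocycle $(\sigma,\tau)\mapsto\iota_v^{-1}(g_\sigma\,{}^\sigma g_\tau\,g_{\sigma\tau}^{-1})$, independent of choices. The map $H^2(k,G_f)\to H^2(k,H_f)$ is induced by the quotient by the diagonal $\mu_2$. *)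

(* Defs.v *)
From HB Require Import structures.
From mathcomp Require Import all_boot all_order all_algebra all_field.
From mathcomp Require Import boolp classical_sets.

Set Implicit Arguments.
Unset Strict Implicit.
Unset Printing Implicit Defensive.

Import GRing.Theory.
Local Open Scope classical_set_scope.
Local Open Scope ring_scope.

Section AbsoluteGaloisGroup.
Variables (k ks : fieldType) (i : {rmorphism k -> ks}).

Definition separable_over (x : ks) : Prop :=
  exists2 p : {poly k}, separable_poly p & root (map_poly i p) x.

Definition separably_closed (K : fieldType) : Prop :=
  forall p : {poly K}, separable_poly p -> (1 < size p)%N -> exists x, root p x.

Definition separable_closure : Prop :=
  (forall x : ks, separable_over x) /\ separably_closed ks.

Record absgal := Gal {
  gal_fun :> {rmorphism ks -> ks};
  gal_bij : bijective gal_fun;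
  gal_fix : forall x : k, gal_fun (i x) = i x }.

Definition gal_comp (s t : absgal) : absgal :=
  @Gal (gal_fun s \o gal_fun t) (bij_comp (gal_bij s) (gal_bij t))
    (fun x => etrans (congr1 s (gal_fix t x)) (gal_fix s x)).

(* [gal_near X s t]: s and t lie in the same basic open set of the Krull      *)
(* topology, namely they agree on the finite set X.                           *)
Definition gal_near (X : seq ks) (s t : absgal) : Prop := {in X, s =1 t}.

End AbsoluteGaloisGroup.

(* A group with an action of Gal(ks/k), presented as a subquotient of a       *)
(* carrier type: its elements are those satisfying [gg_mem], and equality is  *)
(* [gg_eq]. This allows one description of subgroups of SL_n and of their     *)
(* quotients by mu_2.                                                         *)
Record galgroup (k ks : fieldType) (i : {rmorphism k -> ks}) := GalGroup {
  gg_sort :> Type;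
  gg_mem : set gg_sort;
  gg_eq : gg_sort -> gg_sort -> Prop;
  gg_mul : gg_sort -> gg_sort -> gg_sort;
  gg_inv : gg_sort -> gg_sort;
  gg_act : absgal i -> gg_sort -> gg_sort }.

Section Cohomology.
Variables (k ks : fieldType) (i : {rmorphism k -> ks}).
Implicit Types M A B C : galgroup i.

Definition cochain1 M (b : absgal i -> M) : Prop :=
  (forall s, gg_mem (b s)) /\
  (forall s, exists X, forall s', gal_near X s' s -> gg_eq (b s') (b s)).

Definition cochain2 M (c : absgal i -> absgal i -> M) : Prop :=
  (forall s t, gg_mem (c s t)) /\
  (forall s t, exists X, forall s' t',
     gal_near X s' s -> gal_near X t' t -> gg_eq (c s' t') (c s t)).

(* (s, t) |-> b_s . s(b_t) . b_(st)^-1 *)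
Definition coboundary M (b : absgal i -> M) (s t : absgal i) : M :=
  gg_mul (gg_mul (b s) (gg_act s (b t))) (gg_inv (b (gal_comp s t))).

Definition cocycle2 M (c : absgal i -> absgal i -> M) : Prop :=
  cochain2 c /\
  forall r s t, gg_eq (gg_mul (gg_act r (c s t)) (c r (gal_comp s t)))
                      (gg_mul (c r s) (c (gal_comp r s) t)).

Definition cohomologous M (c c' : absgal i -> absgal i -> M) : Prop :=
  exists2 b, cochain1 b &
    forall s t, gg_eq (c s t) (gg_mul (c' s t) (coboundary b s t)).

(* The elements of H^2(k, M), for M abelian, are the cosets [H2class c] of    *)
(* the coboundaries in the group of continuous 2-cocycles.                    *)
Definition H2class M (c : absgal i -> absgal i -> M) : set (absgal i -> absgal i -> M) :=
  [set c' | cocycle2 c' /\ cohomologous c' c].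

Definition H2 M : set (set (absgal i -> absgal i -> M)) :=
  [set d | exists2 c, cocycle2 c & d = H2class c].

Definition H2map A B (phi : A -> B) (d : set (absgal i -> absgal i -> A)) :
    set (absgal i -> absgal i -> B) :=
  [set c' | cocycle2 c' /\
     exists2 c, d c & cohomologous c' (fun s t => phi (c s t))].

(* The image in H^2(k, A) of the class of the 1-cocycle z under the           *)
(* connecting homomorphism of 1 -> A -j-> B -p-> C -> 1: lift z to a cochain  *)
(* u of B and take the coboundary of u, over all lifts u.                     *)
Definition connecting A B C (j : A -> B) (p : B -> C) (z : absgal i -> C) :
    set (absgal i -> absgal i -> A) :=
  [set c | exists u : absgal i -> B,
     [/\ cochain1 u, forall s, gg_eq (p (u s)) (z s) &
       exists2 c0, forall s t, gg_eq (j (c0 s t)) (coboundary u s t) &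
         H2class c0 c]].

End Cohomology.

Arguments H2 {k ks i} M _.
Arguments H2map {k ks i} A B phi d _.

(* A subgroup functor of mu_2 on commutative rings. SL_n modulo [one_pts] is  *)
(* G = SL_n, and SL_n modulo [mu2_pts] is H = SL_n/mu_2.                      *)
Definition center_functor := forall R : comNzRingType, set R.
Definition one_pts : center_functor := fun R => [set c : R | c = 1].
Definition mu2_pts : center_functor := fun R => [set c : R | c ^+ 2 = 1].

Definition eqmod (Z : center_functor) (R : comNzRingType) (E : lmodType R)
    (x y : E) : Prop :=
  exists2 c : R, Z R c & x = c *: y.

Section BinaryForms.
Variable n : nat.

(* f_0 x^n + ... + f_n y^n, with x = 'X and y = 'Y. *)
Definition binary_form (R : nzRingType) (f : 'I_n.+1 -> R) : {poly {poly R}} :=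
  \sum_(j < n.+1) (f j)%:P%:P * 'X^(n - j) * 'Y ^+ j.

(* [is_discriminant f D]: Delta(f) = D. The factorization of f takes place    *)
(* over an extension K of k; D does not depend on it.                         *)
Definition is_discriminant (k : fieldType) (f : 'I_n.+1 -> k) (D : k) : Prop :=
  exists (K : fieldType) (j : {rmorphism k -> K}) (al be : 'I_n -> K),
    binary_form (fun l => j (f l)) =
      \prod_(l < n) ((al l)%:P%:P * 'X - (be l)%:P%:P * 'Y) /\
    j D = \prod_(l < n) \prod_(m < n | (l < m)%N)
            (al l * be m - al m * be l) ^+ 2.

(* The monic g with f(x, 1) = f_0 g(x), when f_0 != 0. *)
Definition monic_part (k : fieldType) (f : 'I_n.+1 -> k) : {poly k} :=
  (f ord0)^-1 *: \sum_(j < n.+1) f j *: 'X^(n - j).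

End BinaryForms.

Section Pencils.
Variable n : nat.

Definition pair_forms (R : comNzRingType) := ('M[R]_n * 'M[R]_n)%type.

Definition map_forms (R R' : comNzRingType) (h : R -> R') (v : pair_forms R) :
    pair_forms R' :=
  (map_mx h v.1, map_mx h v.2).

(* A form A is given by its Gram matrix, A(w, w') = w *m A *m w'^T for row    *)
(* vectors, and x : 'M_n acts on row vectors by w |-> w *m x; so the Gram     *)
(* matrix of (w, w') |-> A(w *m x, w' *m x) is x *m A *m x^T, and this is a   *)
(* left action for the product of matrices.                                   *)
Definition act_forms (R : comNzRingType) (x : 'M[R]_n) (v : pair_forms R) :
    pair_forms R :=
  (x *m v.1 *m x^T, x *m v.2 *m x^T).

Definition form_disc (R : comNzRingType) (A : 'M[R]_n) : R :=
  (-1) ^+ (n * n.-1)./2 * \det A.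

Definition invariant_form (R : comNzRingType) (v : pair_forms R) :
    {poly {poly R}} :=
  form_disc ('X *: map_mx (fun a : R => a%:P%:P) v.1
             - 'Y *: map_mx (fun a : R => a%:P%:P) v.2).

Definition V_ (R : comNzRingType) (f : 'I_n.+1 -> R) : set (pair_forms R) :=
  [set v | [/\ v.1^T = v.1, v.2^T = v.2 & invariant_form v = binary_form f]].

Definition stab (R : comNzRingType) (v : pair_forms R) : set 'M[R]_n :=
  [set x | \det x = 1 /\ act_forms x v = v].

(* The A-self-adjoint operator T with B(w, w') = A(w *m T, w'), for           *)
(* v = (A, B); its characteristic polynomial is g when v has invariant f.     *)
Definition pencil_op (K : fieldType) (v : pair_forms K) : 'M[K]_n :=
  v.2 *m invmx v.1.

Definition eval_mx (R : comNzRingType) (T : 'M[R]_n) (u : {poly R}) : 'M[R]_n :=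
  \sum_(j < size u) u`_j *: T ^+ j.

End Pencils.

(* For p = g viewed over a k-algebra R, {poly %/ p} is the tensor product of  *)
(* L and R over k, so that the sets below are the R-points of Res_(L/k) mu_2  *)
(* and of its subgroup of elements of norm 1.                                 *)
Section RestrictionOfScalars.
Variables (R : comNzRingType) (p : {poly R}).

(* Determinant of the multiplication by u, in the basis of powers of 'X. *)
Definition qnorm (u : {poly %/ p}) : R :=
  \det (\matrix_(a < (size (mk_monic p)).-1, b < (size (mk_monic p)).-1)
          (u * in_qpoly p 'X^a : {poly R})`_b).

Definition res_mu2 : set {poly %/ p} := [set u | u ^+ 2 = 1].

Definition res_mu2_N1 : set {poly %/ p} := [set u | u ^+ 2 = 1 /\ qnorm u = 1].

End RestrictionOfScalars.

(* The map induced by h on coefficients; used when p' is the image of p. *)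
Definition qmap (R R' : comNzRingType) (p : {poly R}) (p' : {poly R'})
    (h : R -> R') (u : {poly %/ p}) : {poly %/ p'} :=
  in_qpoly p' (map_poly h u).

Section ObstructionClass.
Variables (k ks : fieldType) (i : {rmorphism k -> ks}) (n : nat).
Variable Z : center_functor.

(* G(ks) or H(ks), according to Z. Here H(ks) = SL_n(ks)/mu_2(ks) because ks  *)
(* is separably closed of characteristic not 2.                               *)
Definition SL_group : galgroup i :=
  @GalGroup k ks i 'M[ks]_n [set x | \det x = 1] (@eqmod Z ks 'M[ks]_n)
    mulmx invmx (fun s x => map_mx s x).

Variable v : pair_forms n ks.

Definition descent_choice (g : absgal i -> SL_group) : Prop :=
  cochain1 g /\ forall s, act_forms (g s) (map_forms s v) = v.

(* The stabilizer of v with the Galois action twisted by g: this is           *)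
(* G_f(ks) or H_f(ks), the isomorphism iota_v being the identity.             *)
Definition stab_group (g : absgal i -> SL_group) : galgroup i :=
  @GalGroup k ks i 'M[ks]_n (stab v) (@eqmod Z ks 'M[ks]_n)
    mulmx invmx (fun s x => g s *m map_mx s x *m invmx (g s)).

Definition obstruction_class (g : absgal i -> SL_group) :
    set (absgal i -> absgal i -> stab_group g) :=
  @H2class k ks i (stab_group g) (@coboundary k ks i SL_group g).

(* The map u(x) |-> u(T) is an isomorphism from (Res_(L/k) mu_2)_(N=1), resp. *)
(* its quotient by mu_2, to the stabilizer group scheme, where L = k[x]/(p).  *)
(* Group schemes are given by their functors of points on ks-algebras         *)
(* (R, a : ks -> R) together with descent data to k, that is, with their      *)
(* functoriality for s-semilinear maps h : R -> R', s in Gal(ks/k). The       *)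
(* quotients by mu_2 are the presheaf quotients, whose sheafifications are    *)
(* the quotient group schemes.                                                *)
Definition stab_scheme_iso (p : {poly k}) (g : absgal i -> SL_group) : Prop :=
  let T := pencil_op v in
  let pks := map_poly i p in
  (forall (R : comNzRingType) (a : {rmorphism ks -> R}),
     let ev (u : {poly %/ map_poly a pks}) := eval_mx (map_mx a T) u in
     let N1 := @res_mu2_N1 R (map_poly a pks) in
     [/\ forall u, N1 u -> stab (map_forms a v) (ev u),
         forall u w, N1 u -> N1 w -> ev (u * w) = ev u *m ev w,
         forall u w, N1 u -> N1 w ->
           (eqmod Z (ev u) (ev w) <-> @eqmod Z R {poly %/ map_poly a pks} u w) &
         forall x, stab (map_forms a v) x ->
           exists2 u, N1 u & eqmod Z (ev u) x]) /\
  (forall (s : absgal i) (R R' : comNzRingType) (a : {rmorphism ks -> R})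
      (a' : {rmorphism ks -> R'}) (h : {rmorphism R -> R'}),
     (forall y, h (a y) = a' (s y)) ->
     forall u : {poly %/ map_poly a pks}, res_mu2_N1 u ->
       eqmod Z
         (eval_mx (map_mx a' T) (@qmap R R' _ (map_poly a' pks) h u))
         (map_mx a' (g s) *m map_mx h (eval_mx (map_mx a T) u)
            *m map_mx a' (invmx (g s)))).

End ObstructionClass.

Arguments descent_choice {k ks i n Z} v g.
Arguments stab_group {k ks i n Z} v g.
Arguments obstruction_class {k ks i n Z} v g _.
Arguments stab_scheme_iso {k ks i n Z} v p g.

Section ConnectingMap.
Variables (k ks : fieldType) (i : {rmorphism k -> ks}) (p : {poly k}).

Let pks := map_poly i p.

(* In these 2-torsion groups the inverse is the identity map. *)
Definition res_mu2_group : galgroup i :=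
  @GalGroup k ks i {poly %/ pks} (@res_mu2 ks pks) eq *%R id
    (fun s u => @qmap ks ks pks pks s u).

Definition res_mu2_N1_group : galgroup i :=
  @GalGroup k ks i {poly %/ pks} (@res_mu2_N1 ks pks) eq *%R id
    (fun s u => @qmap ks ks pks pks s u).

Definition mu2_group : galgroup i :=
  @GalGroup k ks i ks (@mu2_pts ks) eq *%R id (fun s x => s x).

(* The image of a under k^*/k^*2 = H^1(k, mu_2) -> H^2(k, Res(mu_2)_(N=1)),   *)
(* where a corresponds to the class of s |-> s(b)/b for any b with b^2 = a.   *)
Definition delta0 (a : k) : set (absgal i -> absgal i -> res_mu2_N1_group) :=
  [set c | exists2 b : ks, b ^+ 2 = i a &
     @connecting k ks i res_mu2_N1_group res_mu2_group mu2_group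
       id (@qnorm ks pks) (fun s => s b / b) c].

End ConnectingMap.

Arguments delta0 {k ks} i p a _.

(* Main.v *)
Require Import Defs.
From HB Require Import structures.
From mathcomp Require Import all_boot all_order all_algebra all_field.
From mathcomp Require Import boolp classical_sets.
Set Implicit Arguments.
Unset Strict Implicit.
Unset Printing Implicit Defensive.
Import GRing.Theory.
Local Open Scope classical_set_scope.
Local Open Scope ring_scope.

(* Over the separable closure the operator T = B A^-1 has the n distinct      *)
(* roots lam_l of g as eigenvalues, so it is diagonal in an A-orthogonal      *)
(* basis. Over any extension ring a matrix fixing A and B commutes with T,    *)
(* hence is diag(y) in that basis with y_l^2 = 1; interpolating y at the lam_l*)
(* identifies it with u(T), and det u(T) = N(u).                              *)
(* The basis may be scaled so that A becomes diag(1/g'(lam_l)). Following it  *)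
(* by the Vandermonde matrix gives E carrying v to the pair of forms          *)
(* Tr(ab/g'(x)), Tr(xab/g'(x)) on L, which is defined over k and has          *)
(* discriminant 1; so b = 1/det E has b^2 = f_0. Then g_s s(E)^-1 E fixes v,  *)
(* so it is u_s(T) with N(u_s) = s(b)/b, and the coboundary of u is the       *)
(* obstruction cocycle of g. For H, the two descent choices differ by a       *)
(* cochain of the abelian group stab v.                                       *)

(** Over [ks] both forms become diagonal in one basis ([exists_eigenframe]). An [eigenframe] records
    only identities and explicit inverses, so it passes to every ks-algebra ([map_eigenframe]).
    There the matrices fixing both forms are exactly the u(T) with u^2 = 1, and det u(T) = N(u).
    Since T is equivariant ([pencil_op_act]), the action twisted by g_s corresponds to the action of
    s on the coefficients of u. This gives [stab_scheme_isoP].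

    For G, the point is that v lies in the GL_n-orbit of a pencil defined over k: some invertible E
    carries v to a Galois-fixed pencil ([gal_fix_model]). Then y_s = g_s s(E)^-1 E fixes v, with E
    missing SL_n exactly by its determinant: det y_s = s(b)/b where b = 1/det E, and b^2 = f_0
    because the model has discriminant 1 ([det_model]). So y lifts the Kummer cocycle of f_0 to Res
    mu_2, and its coboundary is that of g ([obstruction_lift]). Two lifts differ by a cochain of
    norm 1, which yields [obstruction_delta0].

    For H, a descent choice h differs from g by e_s = g_s h_s^-1 in the abelian group [stab v], so
    the two obstruction cocycles differ by the coboundary of e ([obstruction_cohomologous]). *)

Section SplitQuotient.
Variables (R : comNzRingType) (n : nat) (lam : 'rV[R]_n) (p : {poly R}).
Hypotheses (n_gt0 : (0 < n)%N)
  (pE : p = \prod_(l < n) ('X - (lam 0 l)%:P)).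

Lemma size_split : size p = n.+1.
Proof. by rewrite pE size_prod_XsubC /index_enum -enumT size_enum_ord. Qed.

(** [mk_monic] replaces a constant or nonmonic modulus by ['X]; since n > 0, the product of linear
    factors is left alone. *)
Lemma mk_monic_split : mk_monic p = p.
Proof. by rewrite /mk_monic size_split ltnS n_gt0 {1}pE monic_prod_XsubC. Qed.

Lemma size_mk_monic_split : size (mk_monic p) = n.+1.
Proof. by rewrite mk_monic_split size_split. Qed.

Lemma size_qpoly_split (u : {poly %/ p}) : (size u <= n)%N.
Proof. by rewrite -ltnS -size_mk_monic_split; apply: size_mk_monic. Qed.

(** Reduction subtracts a multiple of p, which vanishes at each root. *)
Lemma horner_in_qpoly (q : {poly R}) l :
  (in_qpoly p q : {poly R}).[lam 0 l] = q.[lam 0 l].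
Proof.
rewrite /= mk_monic_split.
have pm : p \is monic by rewrite pE monic_prod_XsubC.
rewrite {2}(Pdiv.RingMonic.rdivp_eq pm q) hornerD hornerM.
suff -> : p.[lam 0 l] = 0 by rewrite mulr0 add0r.
by rewrite pE horner_prod (bigD1 l) //= !hornerE subrr mul0r.
Qed.

Lemma horner_qpolyM (u w : {poly %/ p}) l :
  (u * w : {poly %/ p}).[lam 0 l] = u.[lam 0 l] * w.[lam 0 l].
Proof. by rewrite -hornerM -[RHS]horner_in_qpoly. Qed.

Lemma horner_qpoly1 l : (1 : {poly %/ p}).[lam 0 l] = 1.
Proof. exact: hornerC. Qed.

Lemma poly_rV_Vandermonde (q : {poly R}) : (size q <= n)%N ->
  poly_rV q *m Vandermonde n lam = \row_l q.[lam 0 l].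
Proof.
move=> sq; apply/rowP=> l; rewrite !mxE (horner_coef_wide _ sq).
by apply: eq_bigr => j _; rewrite !mxE.
Qed.

(* The rows of multiplication by u are the coefficients of u x^a; evaluating  *)
(* them at the roots diagonalizes this matrix by the Vandermonde matrix.      *)
Lemma qnorm_split (W' : 'M[R]_n) (u : {poly %/ p}) :
    Vandermonde n lam *m W' = 1%:M ->
  qnorm u = \prod_(l < n) u.[lam 0 l].
Proof.
move=> WW'; rewrite /qnorm.
(* The size of the matrix in [qnorm] equals n only propositionally; entries given by a function on
   nat allow the transport. *)
have castE m (F : nat -> nat -> R) : m = n ->
  \det (\matrix_(a < m, b < m) F a b) = \det (\matrix_(a < n, b < n) F a b).
  by move=> ->.
rewrite (castE _ (fun a b => (u * in_qpoly p 'X^a : {poly R})`_b)); last first.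
  by rewrite size_mk_monic_split.
set M := \matrix_(a, b) _.
have MW : M *m Vandermonde n lam =
    Vandermonde n lam *m diag_mx (\row_l u.[lam 0 l]).
  apply/row_matrixP => a; rewrite row_mul.
  have -> : row a M = poly_rV (u * in_qpoly p 'X^a).
    by apply/rowP => b; rewrite !mxE.
  rewrite poly_rV_Vandermonde; last exact: size_qpoly_split.
  apply/rowP=> l; rewrite !mxE horner_qpolyM horner_in_qpoly hornerXn.
  rewrite (bigD1 l) //= big1 => [|m ml]; rewrite !mxE; last first.
    by rewrite (negbTE ml) mulr0n mulr0.
  by rewrite eqxx mulr1n addr0 mulrC.
have MD : M = Vandermonde n lam *m diag_mx (\row_l u.[lam 0 l]) *m W'.
  by rewrite -MW -mulmxA WW' mulmx1.
rewrite MD -mulmxA det_mulmx mulrC -det_mulmx -mulmxA (mulmx1C WW') mulmx1.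
by rewrite det_diag; apply: eq_bigr => l _; rewrite mxE.
Qed.

Lemma qpoly_split_inj (W' : 'M[R]_n) (u w : {poly %/ p}) :
    Vandermonde n lam *m W' = 1%:M ->
  (forall l, u.[lam 0 l] = w.[lam 0 l]) -> u = w.
Proof.
move=> WW' uw; apply: val_inj => /=.
have: (poly_rV u : 'rV_n) = poly_rV w.
  rewrite -[LHS]mulmx1 -[RHS]mulmx1 -WW' !mulmxA !poly_rV_Vandermonde;
    try exact: size_qpoly_split.
  by congr (_ *m _); apply/rowP => l; rewrite !mxE.
by move/(congr1 rVpoly); rewrite !poly_rV_K //; apply: size_qpoly_split.
Qed.

(** Lagrange interpolation; over a ring, an inverse of the Vandermonde matrix takes the place of
    distinctness of the roots. *)
Lemma qpoly_split_interp (W' : 'M[R]_n) (y : 'rV[R]_n) :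
    Vandermonde n lam *m W' = 1%:M ->
  exists u : {poly %/ p}, forall l, u.[lam 0 l] = y 0 l.
Proof.
move=> WW'; exists (in_qpoly p (rVpoly (y *m W'))) => l.
rewrite horner_in_qpoly.
have /rowP/(_ l) := @poly_rV_Vandermonde (rVpoly (y *m W')) (size_poly _ _).
by rewrite rVpolyK -mulmxA (mulmx1C WW') mulmx1 mxE => ->.
Qed.

End SplitQuotient.

(** * Polynomials in a matrix *)

Section EvalMx.
Variables (R : comNzRingType) (n : nat).
Implicit Types (T : 'M[R]_n) (u : {poly R}).

Lemma eval_mx_wide T u m : (size u <= m)%N ->
  eval_mx T u = \sum_(j < m) u`_j *: T ^+ j.
Proof.
move=> sm; rewrite /eval_mx (big_ord_widen m (fun j => u`_j *: T ^+ j) sm).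
rewrite big_mkcond; apply: eq_bigr => j _; case: ltnP => // sj.
by rewrite nth_default // scale0r.
Qed.

Lemma expmx_conj (P P' T T' : 'M[R]_n) j :
  P' *m P = 1%:M -> T = P *m T' *m P' -> T ^+ j = P *m T' ^+ j *m P'.
Proof.
move=> P'P ->; have PP' := mulmx1C P'P; elim: j => [|j IHj].
  by rewrite !expr0 mulmx1 PP'.
by rewrite !exprSr IHj -!mulmxE !mulmxA -(mulmxA _ P' P) P'P mulmx1.
Qed.

Lemma eval_mx_conj (P P' T T' : 'M[R]_n) u :
  P' *m P = 1%:M -> T = P *m T' *m P' -> eval_mx T u = P *m eval_mx T' u *m P'.
Proof.
move=> P'P TE; rewrite /eval_mx mulmx_sumr mulmx_suml.
by apply: eq_bigr => j _; rewrite (expmx_conj _ P'P TE) -scalemxAr -scalemxAl.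
Qed.

Lemma eval_mx_diag (y : 'rV[R]_n) u :
  eval_mx (diag_mx y) u = diag_mx (\row_l u.[y 0 l]).
Proof.
have diagX j : diag_mx y ^+ j = diag_mx (\row_l y 0 l ^+ j).
  elim: j => [|j IHj].
    by rewrite expr0; apply/matrixP => a b; rewrite !mxE expr0.
  rewrite exprSr IHj -mulmxE mulmx_diag; congr diag_mx.
  by apply/rowP => l; rewrite !mxE exprSr.
apply/matrixP => a b; rewrite summxE !mxE horner_coef -sumrMnl.
by apply: eq_bigr => j _; rewrite diagX !mxE mulrnAr.
Qed.

End EvalMx.

Arguments eval_mx_wide {R n T u}.

Lemma map_eval_mx (R R' : comNzRingType) (h : {rmorphism R -> R'}) n
    (T : 'M[R]_n) u :
  map_mx h (eval_mx T u) = eval_mx (map_mx h T) (map_poly h u).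
Proof.
rewrite (eval_mx_wide (u := map_poly h u) (size u) (size_poly _ _)).
rewrite raddf_sum; apply: eq_bigr => j _.
rewrite /= map_mxZ coef_map; congr (_ *: _).
elim: (j : nat) => [|m IHm]; first by rewrite !expr0 map_mx1.
by rewrite !exprSr -!mulmxE map_mxM IHm.
Qed.

(* The pencil v = (A, B), with operator T, in an A-orthogonal eigenbasis Q of *)
(* T: the eigenvalues lam differ by units, and Q A Q^T = diag d.              *)
Record eigenframe (R : comNzRingType) (n : nat) (lam d : 'rV[R]_n)
    (Q Q' T : 'M[R]_n) (v : pair_forms n R) : Prop := Eigenframe {
  frame_inv : Q *m Q' = 1%:M;
  frame_sep : forall l m, l != m -> exists e, (lam 0 l - lam 0 m) * e = 1;
  frame_vand : exists W', Vandermonde n lam *m W' = 1%:M;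
  frame_unit : exists d' : 'rV[R]_n, forall l, d 0 l * d' 0 l = 1;
  frame_op : T = Q' *m diag_mx lam *m Q;
  frame_fst : v.1 = Q' *m diag_mx d *m Q'^T;
  frame_snd : v.2 = Q' *m diag_mx lam *m diag_mx d *m Q'^T }.

Lemma map_diag_mx (R R' : comNzRingType) n (h : {rmorphism R -> R'})
  (y : 'rV[R]_n) : map_mx h (diag_mx y) = diag_mx (map_mx h y).
Proof. by apply/matrixP => a b; rewrite !mxE raddfMn. Qed.

(** Distinctness of eigenvalues is recorded by inverses of their differences, so every field is an
    identity that a ring morphism preserves. *)
Lemma map_eigenframe (R R' : comNzRingType) (h : {rmorphism R -> R'}) n
    (lam d : 'rV[R]_n) Q Q' T v :
  eigenframe lam d Q Q' T v ->
  eigenframe (map_mx h lam) (map_mx h d) (map_mx h Q) (map_mx h Q')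
    (map_mx h T) (map_forms h v).
Proof.
case=> QQ' sep [W' WW'] [d' dd'] -> v1 v2; split.
- by rewrite -map_mxM QQ' map_mx1.
- move=> l m /sep[e le]; exists (h e).
  by rewrite !mxE -rmorphB -rmorphM le rmorph1.
- exists (map_mx h W'); rewrite -(map_mx1 h) -WW' map_mxM; congr (_ *m _).
  by apply/matrixP => a b; rewrite !mxE rmorphXn.
- by exists (map_mx h d') => l; rewrite !mxE -rmorphM dd' rmorph1.
- by rewrite !map_mxM map_diag_mx.
- by rewrite /= v1 map_trmx !map_mxM map_diag_mx.
- by rewrite /= v2 map_trmx !map_mxM !map_diag_mx.
Qed.

(** * The stabilizer in an eigenframe *)

Section EigenframeTheory.
Variables (R : comNzRingType) (n : nat) (lam d : 'rV[R]_n) (Q Q' T : 'M[R]_n).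
Variables (v : pair_forms n R).
Hypothesis frm : eigenframe lam d Q Q' T v.
Implicit Types y z : 'rV[R]_n.

Definition dconj (y : 'rV[R]_n) : 'M[R]_n := Q' *m diag_mx y *m Q.

Lemma dconjM y z : dconj y *m dconj z = dconj (\row_l (y 0 l * z 0 l)).
Proof.
rewrite /dconj !mulmxA -(mulmxA _ Q Q') (frame_inv frm) mulmx1 -(mulmxA Q').
by rewrite mulmx_diag.
Qed.

Lemma dconjC y z : dconj y *m dconj z = dconj z *m dconj y.
Proof. by rewrite !dconjM; congr dconj; apply/rowP=> l; rewrite !mxE mulrC. Qed.

Lemma dconj_inj : injective dconj.
Proof.
move=> y z /(congr1 (fun x => Q *m x *m Q')); rewrite /dconj !mulmxA.
rewrite (frame_inv frm) !mul1mx -!mulmxA (frame_inv frm) !mulmx1 => yz.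
by apply/rowP => l; have /matrixP/(_ l l) := yz; rewrite !mxE eqxx !mulr1n.
Qed.

Lemma scale_dconj c y : c *: dconj y = dconj (c *: y).
Proof. by rewrite /dconj linearZ /= -scalemxAr -scalemxAl. Qed.

Lemma dconj1 : dconj (const_mx 1) = 1%:M.
Proof. by rewrite /dconj diag_const_mx mulmx1 (mulmx1C (frame_inv frm)). Qed.

Lemma det_dconj y : \det (dconj y) = \prod_(l < n) y 0 l.
Proof.
rewrite /dconj -mulmxA det_mulmx mulrC -det_mulmx -mulmxA (frame_inv frm).
by rewrite mulmx1 det_diag.
Qed.

Lemma eval_frame u : eval_mx T u = dconj (\row_l u.[lam 0 l]).
Proof.
by rewrite (eval_mx_conj u (frame_inv frm) (frame_op frm)) eval_mx_diag.
Qed.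

Lemma dconj_fix (y : 'rV[R]_n) :
  (forall l, y 0 l ^+ 2 = 1) -> act_forms (dconj y) v = v.
Proof.
move=> y2; have QQ' := frame_inv frm.
have Q'Q : Q'^T *m Q^T = 1%:M by rewrite -trmx_mul QQ' trmx1.
have fixD z : dconj y *m (Q' *m diag_mx z *m Q'^T) *m (dconj y)^T
    = Q' *m diag_mx z *m Q'^T.
  rewrite /dconj !trmx_mul tr_diag_mx !mulmxA -(mulmxA _ Q'^T) Q'Q mulmx1.
  rewrite -(mulmxA _ Q Q') QQ' mulmx1; congr (_ *m _).
  rewrite -!mulmxA !mulmx_diag; congr (_ *m diag_mx _).
  by apply/rowP => l; rewrite !mxE [z 0 l * _]mulrC mulrA -expr2 y2 mul1r.
apply: injective_projections; rewrite /act_forms /=.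
  by rewrite (frame_fst frm) fixD.
by rewrite (frame_snd frm) -(mulmxA Q') mulmx_diag fixD.
Qed.

(* Fixing both forms forces x to commute with T, hence to be diagonal in the  *)
(* eigenbasis; fixing the first form then makes its entries square to 1.      *)
Lemma fix_dconj x : act_forms x v = v ->
  exists2 y : 'rV[R]_n, forall l, y 0 l ^+ 2 = 1 & x = dconj y.
Proof.
move=> xv; have /= xA := congr1 fst xv; have /= xB := congr1 snd xv.
rewrite (frame_fst frm) in xA; rewrite (frame_snd frm) in xB.
have QQ' := frame_inv frm; have Q'Q := mulmx1C QQ'.
have Q'QT : Q'^T *m Q^T = 1%:M by rewrite -trmx_mul QQ' trmx1.
have [d' dd'] := frame_unit frm.
set D := diag_mx d in xA xB; set L := diag_mx lam in xB.
pose X := Q *m x *m Q'; pose D' := diag_mx d'.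
have DD' : D *m D' = 1%:M.
  rewrite mulmx_diag -diag_const_mx; congr diag_mx.
  by apply/rowP => l; rewrite !mxE dd'.
have XC M : x *m (Q' *m M *m Q'^T) *m x^T = Q' *m M *m Q'^T ->
    X *m M *m X^T = M.
  move/(congr1 (fun E : 'M[R]_n => Q *m E *m Q^T)).
  by rewrite /X !trmx_mul !mulmxA QQ' mul1mx -(mulmxA M) Q'QT mulmx1.
have XD := XC D xA; have XL : X *m (L *m D) *m X^T = L *m D.
  by apply: XC; rewrite (mulmxA Q').
have XQ : X = Q *m x *m Q' by [].
clearbody X.
(* Fixing the first form makes X invertible, with inverse its adjoint for D; cancelling this adjoint
   in [XL] gives commutation with L. *)
have XY : X *m (D *m X^T *m D') = 1%:M by rewrite !mulmxA XD DD'.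
have YX := mulmx1C XY.
have XLC : X *m L = L *m X.
  have : X *m L *m (D *m X^T *m D') = L.
    by rewrite !mulmxA -(mulmxA X) XL -mulmxA DD' mulmx1.
  by move/(congr1 (fun E : 'M[R]_n => E *m X)); rewrite -mulmxA YX mulmx1.
have Xdiag a b : a != b -> X a b = 0.
  move=> ab; have [e le] := frame_sep frm ab.
  have /matrixP/(_ a b) := XLC; rewrite mul_mx_diag mul_diag_mx !mxE => E.
  by rewrite -[LHS]mulr1 -le mulrA mulrBr E [_ * lam 0 a]mulrC subrr mul0r.
have XE : X = diag_mx (\row_l X l l).
  apply/matrixP => a b; rewrite !mxE; case: eqVneq => [->//|/Xdiag->].
  by rewrite mulr0n.
exists (\row_l X l l) => [l|]; last first.
  by rewrite /dconj -XE XQ !mulmxA Q'Q mul1mx -mulmxA Q'Q mulmx1.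
move: XD; rewrite XE tr_diag_mx !mulmx_diag => /matrixP/(_ l l).
rewrite !mxE eqxx !mulr1n => E.
by rewrite -[LHS]mulr1 -(dd' l) expr2 mulrA [_ * d 0 l]mulrAC E dd'.
Qed.

Lemma stab_dconj x : stab v x ->
  exists y : 'rV[R]_n,
    [/\ forall l, y 0 l ^+ 2 = 1, \prod_(l < n) y 0 l = 1 & x = dconj y].
Proof.
case=> dx /fix_dconj[y y2 xE]; exists y; split=> //.
by rewrite -det_dconj -xE.
Qed.

Lemma stabC x x' : stab v x -> stab v x' -> x *m x' = x' *m x.
Proof.
by move=> /stab_dconj[y [_ _ ->]] /stab_dconj[z [_ _ ->]]; apply: dconjC.
Qed.

Lemma stab_sqr x : stab v x -> x *m x = 1%:M.
Proof.
move=> /stab_dconj[y [y2 _ ->]]; rewrite dconjM -dconj1; congr dconj.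
by apply/rowP => l; rewrite !mxE -expr2 y2.
Qed.

Variable p : {poly R}.
Hypotheses (n_gt0 : (0 < n)%N) (pE : p = \prod_(l < n) ('X - (lam 0 l)%:P)).

Lemma eval_frame_inj (u w : {poly %/ p}) : eval_mx T u = eval_mx T w -> u = w.
Proof.
rewrite !eval_frame => /dconj_inj/rowP uw; have [W' WW'] := frame_vand frm.
by apply: (qpoly_split_inj n_gt0 pE WW') => l; have := uw l; rewrite !mxE.
Qed.

Lemma eval_frameM (u w : {poly %/ p}) :
  eval_mx T (u * w : {poly %/ p}) = eval_mx T u *m eval_mx T w.
Proof.
rewrite !eval_frame dconjM; congr dconj; apply/rowP => l; rewrite !mxE.
exact: (horner_qpolyM n_gt0 pE).
Qed.

Lemma eval_frameZ c (u : {poly %/ p}) :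
  eval_mx T (c *: u : {poly %/ p}) = c *: eval_mx T u.
Proof.
rewrite !eval_frame scale_dconj; congr dconj.
by apply/rowP => l; rewrite !mxE hornerZ.
Qed.

Lemma eval_frame1 : eval_mx T (1 : {poly %/ p}) = 1%:M.
Proof.
rewrite eval_frame -dconj1; congr dconj.
by apply/rowP => l; rewrite !mxE hornerC.
Qed.

Lemma qnorm_frame (u : {poly %/ p}) : qnorm u = \det (eval_mx T u).
Proof.
have [W' WW'] := frame_vand frm; rewrite (qnorm_split n_gt0 pE u WW').
by rewrite eval_frame det_dconj; apply: eq_bigr => l _; rewrite mxE.
Qed.

Lemma res_mu2_horner (u : {poly %/ p}) :
  res_mu2 u <-> forall l, u.[lam 0 l] ^+ 2 = 1.
Proof.
have [W' WW'] := frame_vand frm; split=> [u2 l|u2].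
  by rewrite expr2 -(horner_qpolyM n_gt0 pE) -expr2 u2 horner_qpoly1.
apply: (qpoly_split_inj n_gt0 pE WW') => l.
by rewrite expr2 (horner_qpolyM n_gt0 pE) -expr2 u2 horner_qpoly1.
Qed.

Lemma eval_frame_interp y : exists u : {poly %/ p}, eval_mx T u = dconj y.
Proof.
have [W' WW'] := frame_vand frm.
have [u uE] := qpoly_split_interp n_gt0 pE y WW'.
by exists u; rewrite eval_frame; congr dconj; apply/rowP => l; rewrite mxE uE.
Qed.

Lemma res_mu2_frame (u : {poly %/ p}) :
  res_mu2 u <-> act_forms (eval_mx T u) v = v.
Proof.
rewrite eval_frame; split=> [/res_mu2_horner u2|/fix_dconj[y y2 /dconj_inj uy]].
  by apply: dconj_fix => l; rewrite mxE.
by apply/res_mu2_horner => l; rewrite -(y2 l) -uy mxE.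
Qed.

Lemma res_mu2_N1_frame (u : {poly %/ p}) :
  res_mu2_N1 u <-> stab v (eval_mx T u).
Proof.
by rewrite /res_mu2_N1 /stab /= qnorm_frame; split=> -[? ?]; split=> //;
  apply/res_mu2_frame.
Qed.

Lemma fix_eval x : act_forms x v = v ->
  exists2 u : {poly %/ p}, res_mu2 u & eval_mx T u = x.
Proof.
move=> xv; have [y _ xE] := fix_dconj xv.
have [u uE] := eval_frame_interp y; exists u; last by rewrite uE.
by apply/res_mu2_frame; rewrite uE -xE.
Qed.

End EigenframeTheory.

(** * Separability of g and the characteristic polynomial of T *)

Section Dehomogenize.
Variables (R : comNzRingType) (n : nat).

(** The inner variable is y. The value c = 1 yields f_0 g, and c = 0 isolates the leading term f_0
    x^n. *)
Definition set_y (c : R) (F : {poly {poly R}}) : {poly R} :=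
  map_poly (horner_eval c) F.

HB.instance Definition _ c := GRing.RMorphism.copy (set_y c)
  (map_poly (horner_eval c)).

Lemma set_yX c : set_y c 'X = 'X. Proof. exact: map_polyX. Qed.

Lemma set_yY c : set_y c 'Y = c%:P.
Proof. by rewrite /set_y map_polyC /= /horner_eval hornerX. Qed.

Lemma set_yC c (a : R) : set_y c a%:P%:P = a%:P.
Proof. by rewrite /set_y map_polyC /= /horner_eval hornerC. Qed.

Lemma set_y_binary_form c (f : 'I_n.+1 -> R) :
  set_y c (binary_form f) = \sum_(j < n.+1) (f j * c ^+ j) *: 'X^(n - j).
Proof.
rewrite /binary_form rmorph_sum; apply: eq_bigr => j _.
rewrite !rmorphM !rmorphXn /= set_yC set_yX set_yY.
by rewrite mulrAC -polyC_exp -polyCM mul_polyC.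
Qed.

Lemma set_y1_binary_form (f : 'I_n.+1 -> R) :
  set_y 1 (binary_form f) = \sum_(j < n.+1) f j *: 'X^(n - j).
Proof.
by rewrite set_y_binary_form; apply: eq_bigr => j _; rewrite expr1n mulr1.
Qed.

Lemma set_y0_binary_form (f : 'I_n.+1 -> R) :
  set_y 0 (binary_form f) = f ord0 *: 'X^n.
Proof.
rewrite set_y_binary_form big_ord_recl /= expr0 mulr1 subn0.
rewrite big1 ?addr0 // => j _.
by rewrite expr0n /= mulr0 scale0r.
Qed.

Lemma set_y_invariant_form c (v : pair_forms n R) :
  set_y c (invariant_form v) = (-1) ^+ (n * n.-1)./2 *
    \det ('X *: map_mx polyC v.1 - c%:P *: map_mx polyC v.2).
Proof.
rewrite /invariant_form /form_disc rmorphM rmorphXn rmorphN1 -det_map_mx.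
congr (_ * \det _); apply/matrixP => a b; rewrite !mxE.
by rewrite rmorphB !rmorphM /= set_yX set_yY !set_yC.
Qed.

End Dehomogenize.

(** Where f splits, f_0 is the product of the alpha_l, so none of them is 0 and the roots of g are
    beta_l / alpha_l. A repeated root would annihilate a factor of the discriminant. *)
Lemma monic_part_separable (k : fieldType) n (f : 'I_n.+1 -> k) D :
  is_discriminant f D -> D != 0 -> f ord0 != 0 -> separable_poly (monic_part f).
Proof.
case=> [K [j [al [be [fE DE]]]]] D0 f0.
have fac c : set_y c (binary_form (fun l => j (f l))) =
    \prod_(l < n) ((al l) *: 'X - (be l * c)%:P).
  rewrite fE rmorph_prod; apply: eq_bigr => l _.
  rewrite rmorphB !rmorphM /= set_yX set_yY !set_yC.
  by rewrite -polyCM mul_polyC.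
have lead : j (f ord0) = \prod_(l < n) al l.
  have := fac 0; rewrite set_y0_binary_form.
  under eq_bigr do rewrite mulr0 subr0 -mul_polyC.
  rewrite big_split /= prodr_const card_ord -rmorph_prod mul_polyC.
  move/(congr1 (fun q : {poly K} => q`_n)).
  by rewrite !coefZ coefXn eqxx !mulr1.
have al0 l : al l != 0.
  have : j (f ord0) != 0 by rewrite fmorph_eq0.
  by rewrite lead prodf_seq_neq0 => /allP/(_ l (mem_index_enum l)).
rewrite -(separable_map j).
have -> : map_poly j (monic_part f) = \prod_(l < n) ('X - (be l / al l)%:P).
  rewrite /monic_part map_polyZ fmorphV rmorph_sum /=.
  under eq_bigr do rewrite map_polyZ map_polyXn.
  rewrite -set_y1_binary_form fac.
  have -> : \prod_(l < n) (al l *: 'X - (be l * 1)%:P) =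
      j (f ord0) *: \prod_(l < n) ('X - (be l / al l)%:P).
    rewrite lead -mul_polyC rmorph_prod -big_split /=; apply: eq_bigr => l _.
    by rewrite mulrBr mul_polyC -polyCM mulr1 mulrCA divff ?mulr1.
  by rewrite scalerA mulVf ?scale1r // fmorph_eq0.
have -> : \prod_(l < n) ('X - (be l / al l)%:P) =
    \prod_(z <- [seq be l / al l | l <- index_enum 'I_n]) ('X - z%:P).
  by rewrite big_map.
rewrite separable_prod_XsubC map_inj_in_uniq ?index_enum_uniq //.
have jD : j D != 0 by rewrite fmorph_eq0.
have neq (l m : 'I_n) : (l < m)%N -> be l / al l <> be m / al m.
  move=> lm E; move: jD; rewrite DE prodf_seq_neq0.
  move=> /allP/(_ l (mem_index_enum l)).
  rewrite /= prodf_seq_neq0 => /allP/(_ m (mem_index_enum m)).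
  rewrite lm /= expf_eq0 /= subr_eq0 => /negP[]; apply/eqP.
  by rewrite -[be m](mulfVK (al0 m)) -E mulrA [al l * _]mulrC mulfVK // mulrC.
by move=> l m _ _ E; apply/val_inj; case: (ltngtP l m) => // /neq[].
Qed.

(** Roots are split off one at a time: separability passes to the cofactor and keeps the extracted
    root from recurring there. *)
Lemma separably_closed_split (K : fieldType) (p : {poly K}) :
    separably_closed K -> p \is monic -> separable_poly p ->
  exists2 rs, uniq rs & p = \prod_(z <- rs) ('X - z%:P).
Proof.
move=> Kcl; have [m] := ubnP (size p); elim: m p => // m IHm p.
rewrite ltnS => sm pm psep; case: (ltnP 1 (size p)) => sp; last first.
  exists [::] => //; rewrite big_nil.
  have /eqP s1 : size p == 1%N.
    by rewrite eqn_leq sp /= size_poly_gt0 monic_neq0.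
  move/monicP: pm; rewrite lead_coefE s1 /= => lc.
  by rewrite (size1_polyC sp) lc.
have [z /factor_theorem[q pq]] := Kcl p psep sp.
have qm : q \is monic by move: pm; rewrite pq monicMr ?monicXsubC.
have sq : (size q < m)%N.
  apply: leq_trans sm; rewrite pq size_Mmonic ?monic_neq0 ?monicXsubC //.
  by rewrite size_XsubC addn2.
move: psep; rewrite pq separable_root => /andP[qsep qz].
have [rs rsu qE] := IHm q sq qm qsep; exists (z :: rs).
  by rewrite /= rsu andbT; move: qz; rewrite qE root_prod_XsubC.
by rewrite big_cons mulrC -qE.
Qed.

Section PencilChar.
Variables (K : fieldType) (n : nat) (f : 'I_n.+1 -> K) (v : pair_forms n K).
Hypothesis hv : V_ f v.

Let sign_polyC N : (-1) ^+ N = ((-1) ^+ N)%:P :> {poly K}.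
Proof. by rewrite rmorph_sign. Qed.

Lemma form_disc_fst : (-1) ^+ (n * n.-1)./2 * \det v.1 = f ord0.
Proof.
have [_ _ E] := hv; have := set_y0_binary_form f.
rewrite -E set_y_invariant_form.
rewrite scale0r subr0 detZ (det_map_mx (@polyC K)) sign_polyC mulrCA -polyCM.
rewrite mulrC mul_polyC => /(congr1 (fun q : {poly K} => q`_n)).
by rewrite !coefZ coefXn eqxx !mulr1.
Qed.

(** This is xA - B = (x - BA^-1)A; the sign and det A together contribute f_0. *)
Lemma char_poly_pencil_op : f ord0 != 0 ->
  char_poly (pencil_op v) = monic_part f.
Proof.
move=> f0; have [_ _ E] := hv.
have A0 : \det v.1 != 0.
  by apply: contraNneq f0 => A0; rewrite -form_disc_fst A0 mulr0.
have Au : v.1 \in unitmx by rewrite unitmxE unitfE.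
rewrite /monic_part -set_y1_binary_form -E set_y_invariant_form scale1r.
have -> : 'X *: map_mx polyC v.1 - map_mx polyC v.2 =
    char_poly_mx (pencil_op v) *m map_mx polyC v.1.
  rewrite /char_poly_mx mulmxBl mul_scalar_mx -map_mxM /pencil_op.
  by rewrite mulmxKV.
rewrite det_mulmx det_map_mx -/(char_poly _) -form_disc_fst.
rewrite sign_polyC mulrCA -polyCM [char_poly _ * _]mulrC mul_polyC scalerA.
rewrite mulVf ?scale1r //.
by rewrite form_disc_fst.
Qed.

End PencilChar.

(** * Vandermonde determinants and existence of an eigenframe *)

(** The product runs over ordered pairs; each of the n(n-1)/2 unordered pairs gives minus a
    square. *)
Lemma prod_diff_Vandermonde (R : comNzRingType) n (lam : 'rV[R]_n) :
  \prod_(l < n) \prod_(m < n | m != l) (lam 0 l - lam 0 m) =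
  (-1) ^+ (n * n.-1)./2 * \det (Vandermonde n lam) ^+ 2.
Proof.
have splt (l : 'I_n) : \prod_(m < n | m != l) (lam 0 l - lam 0 m) =
   \prod_(m < n | (l < m)%N) (lam 0 l - lam 0 m) *
   \prod_(m < n | (m < l)%N) (lam 0 l - lam 0 m).
  rewrite (bigID (fun m : 'I_n => (l < m)%N)) /=; congr (_ * _);
    apply: eq_bigl => m; rewrite -val_eqE; by case: ltngtP.
under eq_bigr do rewrite splt.
rewrite big_split /= [X in _ * X](exchange_big_dep predT) //= -det_Vandermonde.
have flip : \prod_(l < n) \prod_(m < n | (l < m)%N) (lam 0 l - lam 0 m) =
    \prod_(l < n) \prod_(m < n | (l < m)%N) (-1) * \det (Vandermonde n lam).
  rewrite det_Vandermonde -big_split; apply: eq_bigr => l _.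
  by rewrite -big_split; apply: eq_bigr => m _; rewrite /= mulN1r opprB.
rewrite flip -mulrA -expr2; congr (_ * _).
rewrite (exchange_big_dep predT) //= -bin2 -bin2_sum big_mkord expr_sum.
apply: eq_bigr => m _.
by rewrite -(big_ord_widen _ (fun=> -1)) ?prodr_const ?card_ord // ltnW.
Qed.

Lemma Vandermonde_unit (K : fieldType) n (lam : 'rV[K]_n) :
  injective (lam 0) -> Vandermonde n lam \in unitmx.
Proof.
move=> inj; rewrite unitmxE unitfE det_Vandermonde.
apply/prodf_neq0 => l _; apply/prodf_neq0 => m lm.
by rewrite subr_eq0; apply: contraTneq lm => /inj->; rewrite ltnn.
Qed.

Lemma separably_closed_sqrt (K : fieldType) (c : K) :
  separably_closed K -> (2 : K) != 0 -> c != 0 -> exists b, b ^+ 2 = c.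
Proof.
move=> Kcl two0 c0; have [||b] := Kcl ('X^2 - c%:P).
- rewrite unlock derivB derivC subr0 derivXn /= -scaler_nat expr1.
  by rewrite coprimepZr // coprimepX rootE !hornerE expr0n /= sub0r oppr_eq0.
- by rewrite size_XnsubC.
by rewrite rootE !hornerE subr_eq0 => /eqP; exists b.
Qed.

Lemma row_diag_mul (R : comNzRingType) m n (y : 'rV[R]_m) (M : 'M[R]_(m, n)) l :
  row l (diag_mx y *m M) = y 0 l *: row l M.
Proof. by rewrite row_mul row_diag_mx -scalemxAl -rowE. Qed.

(** Independence of the eigenvectors: a relation cP = 0 multiplied by the powers of T becomes a
    Vandermonde system in the vectors c_l w_l, so each of them vanishes. *)
Lemma eigenvector_matrix (K : fieldType) n (T : 'M[K]_n) (lam : 'rV[K]_n) :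
    injective (lam 0) -> (forall l, root (char_poly T) (lam 0 l)) ->
  exists2 P : 'M[K]_n, P \in unitmx & P *m T = diag_mx lam *m P.
Proof.
move=> inj rt.
have /fin_all_exists2[w wT w0] (l : 'I_n) :
    exists2 w : 'rV_n, w *m T = lam 0 l *: w & w != 0.
  by apply/eigenvalueP; rewrite eigenvalue_root_char.
pose P := \matrix_l w l.
have PT : P *m T = diag_mx lam *m P.
  by apply/row_matrixP => l; rewrite row_mul rowK wT row_diag_mul rowK.
exists P => //; apply: contraT; rewrite unitmxE unitfE negbK => /det0P[c c0 cP].
have cPX j : c *m (diag_mx (\row_l lam 0 l ^+ j)) *m P = 0.
  elim: j => [|j IHj].
    by rewrite -[RHS]cP; congr (_ *m _); apply/rowP => l;
       rewrite mul_mx_diag !mxE expr0 mulr1.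
  have <- : c *m (diag_mx (\row_l lam 0 l ^+ j)) *m P *m T = 0.
    by rewrite IHj mul0mx.
  rewrite -[RHS]mulmxA PT !mulmxA; congr (_ *m _); rewrite -mulmxA mulmx_diag.
  by congr (_ *m diag_mx _); apply/rowP => l; rewrite !mxE exprSr.
have VP : Vandermonde n lam *m (diag_mx c *m P) = 0.
  apply/row_matrixP => j; rewrite row0 -(cPX j) mulmxA row_mul; congr (_ *m _).
  by apply/rowP => l; rewrite !mul_mx_diag !mxE mulrC.
have /row_matrixP cP0 : diag_mx c *m P = 0.
  by rewrite -[LHS](mulKmx (Vandermonde_unit inj)) VP mulmx0.
case/negP: c0; apply/eqP/rowP => l; have := cP0 l.
rewrite row_diag_mul rowK row0 mxE => /eqP.
by rewrite scaler_eq0 (negbTE (w0 l)) orbF => /eqP.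
Qed.

(** T is self-adjoint for A, so the Gram matrix of A on eigenvectors commutes with [diag_mx lam] and
    is diagonal. Square roots in K then rescale its entries to any prescribed nonzero d; this
    freedom is used later to reach the trace form. *)
Lemma exists_eigenframe (K : fieldType) n (v : pair_forms n K)
    (lam d : 'rV[K]_n) :
    separably_closed K -> (2 : K) != 0 ->
    v.1^T = v.1 -> v.2^T = v.2 -> v.1 \in unitmx ->
    injective (lam 0) -> (forall l, root (char_poly (pencil_op v)) (lam 0 l)) ->
    (forall l, d 0 l != 0) ->
  exists Q, eigenframe lam d Q (invmx Q) (pencil_op v) v.
Proof.
move=> Kcl two0 sA sB Au inj rt d0; set T := pencil_op v in rt *.
have [P Pu PT] := eigenvector_matrix inj rt.
have TA : T *m v.1 = v.2 by rewrite /T /pencil_op mulmxKV.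
have AT : v.1 *m T^T = v.2 by rewrite -[v.1 in LHS]sA -trmx_mul TA sB.
pose M := P *m v.1 *m P^T.
have MC : M *m diag_mx lam = diag_mx lam *m M.
  rewrite {2}/M !mulmxA -PT -(mulmxA P) TA -AT /M -!mulmxA.
  by rewrite -(tr_diag_mx lam) -!trmx_mul PT.
have Mu : M \in unitmx by rewrite !unitmx_mul Pu Au unitmx_tr Pu.
have MP : P *m v.1 *m P^T = M by [].
clearbody M.
have ME : M = diag_mx (\row_l M l l).
  apply/matrixP => a b; have /matrixP/(_ a b) := MC.
  rewrite mul_mx_diag mul_diag_mx !mxE; case: eqVneq => [->//|ab] E.
  rewrite mulr0n; apply/eqP; have := subrr (M a b * lam 0 b).
  rewrite {2}E [lam 0 a * _]mulrC -mulrBr => /eqP.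
  rewrite mulf_eq0 => /orP[//|].
  by rewrite subr_eq0 => /eqP/inj ba; rewrite ba eqxx in ab.
have M0 l : M l l != 0.
  move: Mu; rewrite unitmxE unitfE {1}ME det_diag => /prodf_neq0/(_ l isT).
  by rewrite mxE.
have /fin_all_exists[t tE] (l : 'I_n) : exists t, t ^+ 2 = d 0 l / M l l.
  by apply: separably_closed_sqrt => //; rewrite mulf_neq0 ?invr_eq0.
pose Q := diag_mx (\row_l t l) *m P.
have Qu : Q \in unitmx.
  rewrite unitmx_mul Pu andbT unitmxE unitfE det_diag; apply/prodf_neq0 => l _.
  rewrite mxE; apply: contraNneq (d0 l) => t0; move: (tE l).
  rewrite t0 expr0n /=.
  by move/eqP; rewrite eq_sym mulf_eq0 invr_eq0 (negbTE (M0 l)) orbF => /eqP->.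
have QT : Q *m T = diag_mx lam *m Q.
  by rewrite /Q -mulmxA PT !mulmxA !mulmx_diag; congr (diag_mx _ *m _);
     apply/rowP=> l; rewrite !mxE mulrC.
have QA : Q *m v.1 *m Q^T = diag_mx d.
  have -> : Q *m v.1 *m Q^T = diag_mx (\row_l t l) *m M *m diag_mx (\row_l t l).
    by rewrite /Q -MP trmx_mul tr_diag_mx !mulmxA.
  rewrite {1}ME !mulmx_diag; congr diag_mx; apply/rowP => l.
  by rewrite !mxE mulrAC -expr2 tE mulfVK.
clearbody Q.
have QV : invmx Q *m Q = 1%:M by apply: mulVmx.
have QTV : Q^T *m (invmx Q)^T = 1%:M by rewrite -trmx_mul QV trmx1.
have AE : v.1 = invmx Q *m diag_mx d *m (invmx Q)^T.
  by rewrite -QA !mulmxA QV mul1mx -mulmxA QTV mulmx1.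
have TE : T = invmx Q *m diag_mx lam *m Q.
  by rewrite -mulmxA -QT mulKmx.
exists Q; split=> //.
- exact: mulmxV.
- move=> l m lm; exists (lam 0 l - lam 0 m)^-1; rewrite divff // subr_eq0.
  by apply: contraNneq lm => /inj->.
- by exists (invmx (Vandermonde n lam)); rewrite mulmxV ?Vandermonde_unit.
- by exists (\row_l (d 0 l)^-1) => l; rewrite mxE divff.
by rewrite -TA {1}TE {1}AE !mulmxA -(mulmxA _ Q) mulmxV // mulmx1.
Qed.

(** * Cohomology with coefficients in groups of exponent 2 *)

(** Cochains are functions on these records, so the cocycle identities require equality of
    automorphisms as records. *)
Lemma absgal_ext (k ks : fieldType) (i : {rmorphism k -> ks}) (s t : absgal i) :
  s =1 t -> s = t.
Proof.
case: s t => [s sb sf] [t tb tf] /= st.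
have {}st : s = t.
  case: s t st {sb sf tb tf} => [s [[sa] [sm]]] [t [[ta] [tm]]] /= /funext st.
  case: _ / st ta tm => ta tm.
  congr (GRing.RMorphism.Pack (GRing.RMorphism.Class _ _));
    congr (_ _); apply: Prop_irrelevance.
by subst t; rewrite (Prop_irrelevance sb tb) (Prop_irrelevance sf tf).
Qed.

Lemma gal_compA (k ks : fieldType) (i : {rmorphism k -> ks})
    (r s t : absgal i) :
  gal_comp r (gal_comp s t) = gal_comp (gal_comp r s) t.
Proof. exact: absgal_ext. Qed.

(** Abelian Galois groups of exponent 2. The stabilizers commute and square to 1 already as
    matrices, before any quotient by mu_2, so these laws are Leibniz equalities and [gg_eq] enters
    only through congruence. *)
Record elementary (k ks : fieldType) (i : {rmorphism k -> ks})
    (M : galgroup i) : Prop := Elementary {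
  elem_refl : forall x : M, gg_eq x x;
  elem_sym : forall x y : M, gg_eq x y -> gg_eq y x;
  elem_trans : forall x y z : M, gg_eq x y -> gg_eq y z -> gg_eq x z;
  elem_eqM : forall x x' y y' : M,
    gg_eq x x' -> gg_eq y y' -> gg_eq (gg_mul x y) (gg_mul x' y');
  elem_memM : forall x y : M, gg_mem x -> gg_mem y -> gg_mem (gg_mul x y);
  elem_memA : forall s (x : M), gg_mem x -> gg_mem (gg_act s x);
  elem_mulA : forall x y z : M, gg_mul x (gg_mul y z) = gg_mul (gg_mul x y) z;
  elem_mulC : forall x y : M, gg_mem x -> gg_mem y -> gg_mul x y = gg_mul y x;
  elem_mulK : forall x y : M, gg_mem y -> gg_mul (gg_mul x y) y = x;
  elem_inv : forall x : M, gg_mem x -> gg_inv x = x;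
  elem_actM : forall s (x y : M), gg_mem x -> gg_mem y ->
    gg_act s (gg_mul x y) = gg_mul (gg_act s x) (gg_act s y) }.

Section ElementaryCohomology.
Variables (k ks : fieldType) (i : {rmorphism k -> ks}) (M : galgroup i).
Hypothesis eM : elementary M.
Implicit Types (b : absgal i -> M) (c : absgal i -> absgal i -> M).

Lemma cochain1M b b' : cochain1 b -> cochain1 b' ->
  cochain1 (fun s => gg_mul (b s) (b' s)).
Proof.
move=> [bm bc] [bm' bc']; split=> s; first exact: elem_memM.
have [X Xb] := bc s; have [X' Xb'] := bc' s; exists (X ++ X') => s' near.
by apply: elem_eqM => //; [apply: Xb | apply: Xb'] => z zX; apply: near;
  rewrite mem_cat zX ?orbT.
Qed.

Lemma coboundary_mem b s t :
  (forall s, gg_mem (b s)) -> gg_mem (coboundary b s t).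
Proof.
move=> bm; rewrite /coboundary (elem_inv eM) //.
by apply: elem_memM => //; apply: elem_memM => //; apply: elem_memA.
Qed.

Lemma coboundaryM b b' s t :
    (forall s, gg_mem (b s)) -> (forall s, gg_mem (b' s)) ->
  coboundary (fun s => gg_mul (b s) (b' s)) s t =
  gg_mul (coboundary b s t) (coboundary b' s t).
Proof.
move=> bm bm'; rewrite /coboundary !(elem_inv eM) //; last exact: elem_memM.
rewrite (elem_actM eM) //.
have med (x x' y y' z z' : M) :
    gg_mem x' -> gg_mem y -> gg_mem y' -> gg_mem z ->
    gg_mul (gg_mul (gg_mul x x') (gg_mul y y')) (gg_mul z z') =
    gg_mul (gg_mul (gg_mul x y) z) (gg_mul (gg_mul x' y') z').
  move=> mx' my my' mz; rewrite !(elem_mulA eM) -(elem_mulA eM x x').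
  rewrite (elem_mulC eM mx' my); congr (gg_mul _ z').
  rewrite -!(elem_mulA eM); do 2!congr (gg_mul _ _).
  by rewrite (elem_mulA eM) (elem_mulC eM _ mz) //; apply: elem_memM.
by apply: med => //; apply: elem_memA.
Qed.

(** A [galgroup] carries no unit; the constant cochain x x serves instead, its coboundary being a
    square. *)
Lemma cohomologous_refl c (x : M) : gg_mem x -> cohomologous c c.
Proof.
move=> mx; have c1 : cochain1 (fun _ : absgal i => x).
  by split=> // s; exists [::] => s' _; apply: elem_refl.
exists (fun _ => gg_mul x x); first exact: cochain1M.
move=> s t; rewrite (coboundaryM s t c1.1 c1.1) (elem_mulA eM) (elem_mulK eM).
  exact: elem_refl.
exact: coboundary_mem c1.1.
Qed.

Lemma cohomologous_sym c c' : cohomologous c c' -> cohomologous c' c.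
Proof.
case=> b [bm bc] cb; exists b => // s t; apply: elem_sym => //.
apply: (elem_trans eM) (elem_eqM eM (cb s t) (elem_refl eM _)) _.
rewrite (elem_mulK eM); first exact: elem_refl.
exact: coboundary_mem.
Qed.

Lemma cohomologous_trans c c' c'' :
  cohomologous c c' -> cohomologous c' c'' -> cohomologous c c''.
Proof.
move=> [b b1 cb] [b' b1' cb']; exists (fun s => gg_mul (b' s) (b s)).
  exact: cochain1M.
move=> s t; apply: (elem_trans eM) (cb s t) _.
rewrite (coboundaryM s t b1'.1 b1.1) (elem_mulA eM).
exact: (elem_eqM eM (cb' s t) (elem_refl eM _)).
Qed.

End ElementaryCohomology.

Record galgroup_morph (k ks : fieldType) (i : {rmorphism k -> ks})
    (A B : galgroup i) (phi : A -> B) : Prop := GalgroupMorph {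
  morph_mem : forall x : A, gg_mem x -> gg_mem (phi x);
  morph_eq : forall x y : A, gg_eq x y -> gg_eq (phi x) (phi y);
  morph_mul : forall x y : A, gg_mem x -> gg_mem y ->
    phi (gg_mul x y) = gg_mul (phi x) (phi y);
  morph_act : forall s (x : A), gg_mem x ->
    phi (gg_act s x) = gg_act s (phi x) }.

Section MorphCohomology.
Variables (k ks : fieldType) (i : {rmorphism k -> ks}) (A B : galgroup i).
Variable phi : A -> B.
Hypotheses (eA : elementary A) (eB : elementary B) (mphi : galgroup_morph phi).

Lemma morph_coboundary b s t : (forall s, gg_mem (b s)) ->
  phi (coboundary b s t) = coboundary (fun s => phi (b s)) s t.
Proof.
move=> bm; rewrite /coboundary (elem_inv eA) // (elem_inv eB); last first.
  exact: morph_mem.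
have bmt := elem_memA eA s (bm t).
by rewrite !(morph_mul mphi) ?(morph_act mphi) //; apply: elem_memM.
Qed.

Lemma morph_cochain1 b : cochain1 b -> cochain1 (fun s => phi (b s)).
Proof.
move=> [bm bc]; split=> s; first exact: morph_mem.
by have [X Xb] := bc s; exists X => s' /Xb; apply: morph_eq.
Qed.

Lemma morph_cohomologous c c' : (forall s t, gg_mem (c' s t)) ->
  cohomologous c c' ->
  cohomologous (fun s t => phi (c s t)) (fun s t => phi (c' s t)).
Proof.
move=> cm [b b1 cb]; exists (fun s => phi (b s)); first exact: morph_cochain1.
move=> s t; have := morph_eq mphi (cb s t); have bm := b1.1.
by rewrite (morph_mul mphi) ?morph_coboundary //; apply: coboundary_mem.
Qed.

End MorphCohomology.

(** * The twisted stabilizer and its cocycle, for G and H at once *)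

Record mu2_subfunctor (Z : center_functor) : Prop := Mu2Subfunctor {
  center1 : forall R, Z R 1;
  centerM : forall R c d, Z R c -> Z R d -> Z R (c * d);
  center_sqr : forall R c, Z R c -> c ^+ 2 = 1;
  center_map : forall (R R' : comNzRingType) (h : {rmorphism R -> R'}) c,
    Z R c -> Z R' (h c) }.

Lemma one_pts_subfunctor : mu2_subfunctor one_pts.
Proof.
split=> [R|R c d|R c|R R' h c]; rewrite /one_pts //= => -> *.
- by rewrite mul1r.
- by rewrite expr1n.
by rewrite rmorph1.
Qed.

Lemma mu2_pts_subfunctor : mu2_subfunctor mu2_pts.
Proof.
split=> [R|R c d|R c|R R' h c]; rewrite /mu2_pts //=; first by rewrite expr1n.
  by move=> c2 d2; rewrite exprMn c2 d2 mulr1.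
by move=> c2; rewrite -rmorphXn c2 rmorph1.
Qed.

Section ActForms.
Variables (R : comNzRingType) (n : nat).
Implicit Types (x y : 'M[R]_n) (v : pair_forms n R).

Lemma act_formsM x y v : act_forms (x *m y) v = act_forms x (act_forms y v).
Proof. by rewrite /act_forms /= trmx_mul !mulmxA. Qed.

Lemma act_forms1 v : act_forms 1%:M v = v.
Proof. by case: v => A B; rewrite /act_forms /= trmx1 !mulmx1 !mul1mx. Qed.

End ActForms.

Lemma map_act_forms (R R' : comNzRingType) (h : {rmorphism R -> R'}) n
    (x : 'M[R]_n) v :
  map_forms h (act_forms x v) = act_forms (map_mx h x) (map_forms h v).
Proof. by rewrite /map_forms /act_forms /= !map_mxM map_trmx. Qed.

Section EqMod.
Variables (Z : center_functor) (hZ : mu2_subfunctor Z).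

Section Lmod.
Variables (R : comNzRingType) (E : lmodType R).
Implicit Types x y z : E.

Lemma eqmod_refl x : eqmod Z x x.
Proof. by exists 1; rewrite ?scale1r //; apply: center1. Qed.

Lemma eqmod_sym x y : eqmod Z x y -> eqmod Z y x.
Proof.
move=> [c cZ ->]; exists c => //.
by rewrite scalerA -expr2 (center_sqr hZ cZ) scale1r.
Qed.

Lemma eqmod_trans x y z : eqmod Z x y -> eqmod Z y z -> eqmod Z x z.
Proof.
move=> [c cZ ->] [d dZ ->]; exists (c * d); first exact: centerM.
by rewrite scalerA.
Qed.

End Lmod.

Variables (K : fieldType) (n : nat).
Implicit Types x y : 'M[K]_n.

Lemma eqmod_mulmx x x' y y' :
  eqmod Z x x' -> eqmod Z y y' -> eqmod Z (x *m y) (x' *m y').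
Proof.
move=> [c cZ ->] [d dZ ->]; exists (c * d); first exact: centerM.
by rewrite -scalemxAl -scalemxAr scalerA.
Qed.

Lemma eqmod_invmx x x' :
  x' \in unitmx -> eqmod Z x x' -> eqmod Z (invmx x) (invmx x').
Proof.
move=> xu [c cZ ->]; exists c => //; have c2 := center_sqr hZ cZ.
have cxu : c *: x' \in unitmx.
  rewrite unitmxE detZ unitrM -unitmxE xu andbT unitrX // unitfE.
  by apply: contra_eq_neq c2 => ->; rewrite expr0n /= eq_sym oner_neq0.
rewrite -[LHS]mulmx1 -(mulmxV xu) mulmxA -[x' in _ *m x' *m _]scale1r -c2.
by rewrite expr2 -scalerA -scalemxAr mulVmx // -scalemxAl mul1mx.
Qed.

End EqMod.

Section StabGroup.
Variables (k ks : fieldType) (i : {rmorphism k -> ks}) (n : nat).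
Variables (Z : center_functor) (hZ : mu2_subfunctor Z).
Variables (v : pair_forms n ks) (g : absgal i -> SL_group i n Z).
Hypothesis hg : descent_choice v g.

Lemma descent_unit s : g s \in unitmx.
Proof. by have [[/(_ s) /= dg _] _] := hg; rewrite unitmxE dg unitr1. Qed.

Lemma descent_act s : act_forms (g s) (map_forms s v) = v.
Proof. exact: hg.2. Qed.

Lemma descent_actV s : act_forms (invmx (g s)) v = map_forms s v.
Proof.
by rewrite -{1}(descent_act s) -act_formsM mulVmx ?descent_unit // act_forms1.
Qed.

Lemma act_fix s x : act_forms x v = v ->
  act_forms (g s *m map_mx s x *m invmx (g s)) v = v.
Proof.
by move=> xv; rewrite !act_formsM descent_actV -map_act_forms xv descent_act.
Qed.

Lemma stab_act s x : stab v x -> stab v (g s *m map_mx s x *m invmx (g s)).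
Proof.
move=> [dx xv]; split; last exact: act_fix.
have dg : \det (g s) = 1 by exact: hg.1.1.
by rewrite !det_mulmx det_inv dg det_map_mx dx rmorph1 invr1 !mulr1.
Qed.

(** Replacing (A, B) by (xAx^T, xBx^T) conjugates BA^-1 by x; here x = g_s, which carries the
    conjugate of v back to v. *)
Lemma pencil_op_act s : v.1 \in unitmx ->
  pencil_op v = g s *m map_mx s (pencil_op v) *m invmx (g s).
Proof.
move=> Au; have gu := descent_unit s.
have E1 : g s *m map_mx s v.1 *m (g s)^T = v.1 := congr1 fst (descent_act s).
have E2 : g s *m map_mx s v.2 *m (g s)^T = v.2 := congr1 snd (descent_act s).
apply: (can_inj (mulmxK Au)).
have TA : pencil_op v *m v.1 = v.2 by rewrite /pencil_op mulmxKV.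
rewrite TA -[v.1 in RHS]E1 -[LHS]E2 !mulmxA mulmxKV //; congr (_ *m _).
by rewrite -mulmxA -map_mxM TA.
Qed.

Lemma stab_mul x y : stab v x -> stab v y -> stab v (x *m y).
Proof.
move=> [dx xv] [dy yv].
by split; rewrite ?det_mulmx ?dx ?dy ?mulr1 // act_formsM yv xv.
Qed.

Lemma coboundary_stab s t : stab v (@coboundary _ _ i (SL_group i n Z) g s t).
Proof.
have dg s' : \det (g s') = 1 by exact: hg.1.1.
rewrite /coboundary /=; split.
  by rewrite !det_mulmx det_inv det_map_mx !dg rmorph1 invr1 !mulr1.
rewrite !act_formsM descent_actV.
have -> : map_forms (gal_comp s t) v = map_forms s (map_forms t v).
  by congr pair; apply/matrixP => a b; rewrite !mxE.
by rewrite -map_act_forms !descent_act.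
Qed.

Lemma coboundary_cocycle2 :
  @cocycle2 _ _ i (stab_group v g) (@coboundary _ _ i (SL_group i n Z) g).
Proof.
have [[gm gc] _] := hg.
split; first split; first exact: coboundary_stab.
- move=> s t; have [X1 h1] := gc s; have [X2 h2] := gc t.
  have [X3 h3] := gc (gal_comp s t).
  pose ent := [seq g t a b | a <- enum 'I_n, b <- enum 'I_n].
  (* [map t X3] with [X3] makes s't' agree with st on [X3]; [ent] makes s' and s agree on the
     entries of g_t. *)
  exists (X1 ++ X2 ++ X3 ++ map t X3 ++ ent) => s' t' ns nt.
  rewrite /coboundary /=.
  apply: eqmod_mulmx => //; first apply: eqmod_mulmx => //.
  + by apply: h1 => z zX; apply: ns; rewrite mem_cat zX.
  + have -> : map_mx s (g t) = map_mx s' (g t).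
      apply/matrixP => a b; rewrite !mxE ns // !mem_cat.
      do 4!(apply/orP; right).
      by apply/allpairsP; exists (a, b); rewrite !mem_enum.
    have [c cZ ->] : eqmod Z (g t') (g t).
      by apply: h2 => z zX; apply: nt; rewrite !mem_cat zX orbT.
    by exists (s' c); [apply: center_map | rewrite map_mxZ].
  apply: eqmod_invmx => //; first exact: descent_unit.
  apply: h3 => z zX /=; rewrite nt ?ns //; last by rewrite !mem_cat zX !orbT.
  by rewrite !mem_cat (map_f t zX) !orbT.
move=> r s t; rewrite /= /coboundary /= gal_compA.
have -> : map_mx r (g s *m map_mx s (g t) *m invmx (g (gal_comp s t))) =
    map_mx r (g s) *m map_mx (gal_comp r s) (g t) *m
      invmx (map_mx r (g (gal_comp s t))).
  rewrite !map_mxM map_invmx; congr (_ *m _ *m _).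
  by apply/matrixP => a b; rewrite !mxE.
have mu : map_mx r (g (gal_comp s t)) \in unitmx.
  by rewrite map_unitmx descent_unit.
rewrite !mulmxA !mulmxKV ?descent_unit // ?mulmxKV //.
exact: eqmod_refl.
Qed.

Variables (lam d : 'rV[ks]_n) (Q Q' T : 'M[ks]_n).
Hypothesis frm : eigenframe lam d Q Q' T v.

Lemma stab_group_elementary : elementary (stab_group v g).
Proof.
have inv x : stab v x -> invmx x = x.
  move=> /(stab_sqr frm) xx; have xu := (mulmx1_unit xx).1.
  by rewrite -[LHS]mulmx1 -xx mulmxA mulVmx // mul1mx.
split=> /=.
- exact: eqmod_refl.
- exact: eqmod_sym.
- exact: eqmod_trans.
- by move=> x x' y y'; apply: eqmod_mulmx.
- exact: stab_mul.
- by move=> s x; apply: stab_act.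
- exact: mulmxA.
- exact: stabC frm.
- by move=> x y /(stab_sqr frm) yy; rewrite -mulmxA yy mulmx1.
- exact: inv.
move=> s x y _ _; rewrite map_mxM !mulmxA; congr (_ *m _).
by rewrite mulmxKV ?descent_unit.
Qed.

End StabGroup.

(** * The stabilizer group scheme *)

Lemma map_poly_split (R R' : comNzRingType) (h : {rmorphism R -> R'}) n
    (lam : 'rV[R]_n) :
  map_poly h (\prod_(l < n) ('X - (lam 0 l)%:P)) =
  \prod_(l < n) ('X - ((map_mx h lam) 0 l)%:P).
Proof.
rewrite rmorph_prod; apply: eq_bigr => l _.
by rewrite rmorphB /= map_polyX map_polyC mxE.
Qed.

(** Mapping coefficients keeps the degree below n, so no reduction occurs. With P = g_s this matches
    the action on coefficients with the twisted action. *)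
Lemma eval_qmap (R R' : comNzRingType) (h : {rmorphism R -> R'}) n
    (q : {poly R}) (q' : {poly R'}) (lam : 'rV[R]_n) (lam' : 'rV[R']_n)
    (T : 'M[R]_n) (T' P P' : 'M[R']_n) (u : {poly %/ q}) :
    (0 < n)%N -> q = \prod_(l < n) ('X - (lam 0 l)%:P) ->
    q' = \prod_(l < n) ('X - (lam' 0 l)%:P) ->
    P' *m P = 1%:M -> T' = P *m map_mx h T *m P' ->
  eval_mx T' (@qmap R R' q q' h u) = P *m map_mx h (eval_mx T u) *m P'.
Proof.
move=> n_gt0 qE qE' P'P TE; rewrite /qmap in_qpoly_small; last first.
  rewrite (size_mk_monic_split n_gt0 qE') ltnS.
  exact: leq_trans (size_poly _ _) (size_qpoly_split n_gt0 qE u).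
by rewrite map_eval_mx; apply: eval_mx_conj.
Qed.

Lemma stab_scheme_isoP (k ks : fieldType) (i : {rmorphism k -> ks}) (n : nat)
    (Z : center_functor) (v : pair_forms n ks) (g : absgal i -> SL_group i n Z)
    (lam d : 'rV[ks]_n) (Q Q' : 'M[ks]_n) (p : {poly k}) :
    mu2_subfunctor Z -> descent_choice v g -> (0 < n)%N ->
    eigenframe lam d Q Q' (pencil_op v) v ->
    v.1 \in unitmx ->
    map_poly i p = \prod_(l < n) ('X - (lam 0 l)%:P) ->
  stab_scheme_iso v p g.
Proof.
move=> hZ hg n_gt0 frm Au pE; split=> [R a|s R R' a a' h ha u _].
  have frmR := map_eigenframe a frm.
  have pR := map_poly_split a lam; rewrite -pE in pR.
  split.
  - by move=> u /(res_mu2_N1_frame frmR n_gt0 pR).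
  - by move=> u w _ _; apply: (eval_frameM frmR n_gt0 pR).
  - move=> u w _ _; split=> -[c cZ E]; exists c => //.
      by apply: (eval_frame_inj frmR n_gt0 pR); rewrite E (eval_frameZ frmR).
    by rewrite E (eval_frameZ frmR).
  move=> x xs; have [u _ uE] := fix_eval frmR n_gt0 pR xs.2.
  exists u; last by rewrite uE; apply: eqmod_refl.
  by apply/(res_mu2_N1_frame frmR n_gt0 pR); rewrite uE.
have pR' := map_poly_split a' lam; have pR := map_poly_split a lam.
rewrite -pE in pR pR'.
rewrite (eval_qmap (P := map_mx a' (g s)) (P' := map_mx a' (invmx (g s)))
  (T := map_mx a (pencil_op v)) u n_gt0 pR pR'); first exact: eqmod_refl.
  by rewrite -map_mxM mulVmx ?map_mx1 ?(descent_unit hg).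
rewrite {1}(pencil_op_act hg s Au) 2!map_mxM; congr (_ *m _ *m _).
by move: (pencil_op v) => T; apply/matrixP => x y; rewrite !mxE ha.
Qed.

(* The weights 1/g'(lam_l) of the form (a, b) |-> Tr(a b / g'(x)) on L.       *)
Definition root_weight (K : fieldType) n (lam : 'rV[K]_n) : 'rV[K]_n :=
  \row_l (\prod_(m < n | m != l) (lam 0 l - lam 0 m))^-1.

Lemma root_weight_neq0 (K : fieldType) n (lam : 'rV[K]_n) l :
  injective (lam 0) -> root_weight lam 0 l != 0.
Proof.
move=> inj; rewrite mxE invr_eq0; apply/prodf_neq0 => m ml.
by rewrite subr_eq0; apply: contraNneq ml => /inj->.
Qed.

(** The left side is the determinant of the trace form in the basis of powers of x; its sign is the
    one that [form_disc] cancels. *)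
Lemma prod_root_weight (K : fieldType) n (lam : 'rV[K]_n) :
    injective (lam 0) ->
  \prod_(l < n) root_weight lam 0 l * \det (Vandermonde n lam) ^+ 2 =
  (-1) ^+ (n * n.-1)./2.
Proof.
move=> inj; under eq_bigr do rewrite mxE.
have W0 : \det (Vandermonde n lam) != 0.
  by rewrite -unitfE -unitmxE Vandermonde_unit.
rewrite prodfV prod_diff_Vandermonde invfM mulfVK ?expf_neq0 //.
by rewrite -exprVn invrN1.
Qed.

(** * The trace-form pencil as a Galois-fixed model *)

Section GaloisFixed.
Variables (k ks : fieldType) (i : {rmorphism k -> ks}) (n : nat).
Variables (p : {poly k}) (lam : 'rV[ks]_n).
Hypotheses (inj : injective (lam 0))
  (pE : map_poly i p = \prod_(l < n) ('X - (lam 0 l)%:P)).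

Lemma gal_permutes_roots (s : absgal i) :
  exists2 pi : 'I_n -> 'I_n,
    injective pi & forall l, s (lam 0 l) = lam 0 (pi l).
Proof.
have /fin_all_exists[pi piE] (l : 'I_n) : exists m, s (lam 0 l) = lam 0 m.
  have sp : map_poly s (map_poly i p) = map_poly i p.
    by apply/polyP => j; rewrite !coef_map /= gal_fix.
  have : root (map_poly i p) (s (lam 0 l)).
    rewrite -sp rmorph_root // pE rootE horner_prod (bigD1 l) //=.
    by rewrite hornerXsubC subrr mul0r.
  rewrite pE rootE horner_prod => /prodf_eq0[m _].
  by rewrite hornerXsubC subr_eq0 => /eqP ->; exists m.
exists pi => // l m lm; apply: inj; apply: (fmorph_inj s).
by rewrite !piE lm.
Qed.

(* The entries are sums over all roots of g, which Galois permutes.           *)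
Lemma gal_fix_trace_form (s : absgal i) (y : 'rV[ks]_n) :
    (forall pi : 'I_n -> 'I_n, injective pi ->
      (forall l, s (lam 0 l) = lam 0 (pi l)) ->
      forall l, s (y 0 l) = y 0 (pi l)) ->
  let M := Vandermonde n lam *m diag_mx y *m (Vandermonde n lam)^T in
  map_mx s M = M.
Proof.
have [pi pi_inj piE] := gal_permutes_roots s => /(_ pi pi_inj piE) yE.
have ME a b : (Vandermonde n lam *m diag_mx y *m (Vandermonde n lam)^T) a b =
    \sum_l lam 0 l ^+ a * y 0 l * lam 0 l ^+ b.
  by rewrite mul_mx_diag mxE; apply: eq_bigr => l _; rewrite !mxE.
apply/matrixP => a b; rewrite mxE ME rmorph_sum /= [RHS](reindex_inj pi_inj) /=.
by apply: eq_bigr => l _; rewrite !rmorphM !rmorphXn /= yE !piE.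
Qed.

Lemma gal_root_weight (s : absgal i) (pi : 'I_n -> 'I_n) l :
    injective pi -> (forall l, s (lam 0 l) = lam 0 (pi l)) ->
  s (root_weight lam 0 l) = root_weight lam 0 (pi l).
Proof.
move=> pi_inj piE; rewrite !mxE fmorphV rmorph_prod /=; congr (_^-1).
rewrite [RHS](reindex_inj pi_inj) /=; apply: eq_big => m.
  by rewrite (inj_eq pi_inj).
by rewrite rmorphB /= !piE.
Qed.

Variables (Q Q' T : 'M[ks]_n) (v : pair_forms n ks).
Hypothesis frm : eigenframe lam (root_weight lam) Q Q' T v.

Let W := Vandermonde n lam.

(* Base change by W Q carries v to the form (a, b) |-> Tr(a b / g'(x)) on L   *)
(* and its multiple by x, which are defined over k.                           *)
Lemma gal_fix_model (s : absgal i) :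
  map_forms s (act_forms (W *m Q) v) = act_forms (W *m Q) v.
Proof.
have QQ' := frame_inv frm.
have Q'QT : Q'^T *m Q^T = 1%:M by rewrite -trmx_mul QQ' trmx1.
have modelE M : W *m Q *m (Q' *m M *m Q'^T) *m (W *m Q)^T = W *m M *m W^T.
  rewrite trmx_mul !mulmxA -(mulmxA W) QQ' mulmx1.
  by rewrite -(mulmxA _ Q'^T) Q'QT mulmx1.
congr pair; rewrite /= ?(frame_fst frm) ?(frame_snd frm).
  rewrite modelE; apply: gal_fix_trace_form => pi pi_inj piE l.
  exact: gal_root_weight.
rewrite -(mulmxA Q') modelE mulmx_diag.
apply: gal_fix_trace_form => pi pi_inj piE l.
by rewrite mxE rmorphM /= piE (gal_root_weight _ pi_inj piE) [RHS]mxE.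
Qed.

Lemma det_model : \det (W *m Q) ^+ 2 * \det v.1 = (-1) ^+ (n * n.-1)./2.
Proof.
rewrite -(prod_root_weight inj) (frame_fst frm) !det_mulmx det_tr det_diag.
have : \det Q * \det Q' = 1 by rewrite -det_mulmx (frame_inv frm) det1.
rewrite -/W; set w := \det W; set q := \det Q; set q' := \det Q'.
set P := \prod_(_ < _) _.
move=> qq'; rewrite exprMn [q' * P]mulrC -(mulrA P) -expr2 mulrACA -exprMn qq'.
by rewrite expr1n mulr1 mulrC.
Qed.

End GaloisFixed.

(** * The obstruction class for G *)

Section ObstructionOfG.
Variables (k ks : fieldType) (i : {rmorphism k -> ks}) (n : nat).
Variables (p : {poly k}) (lam d : 'rV[ks]_n) (Q Q' : 'M[ks]_n).
Variables (v : pair_forms n ks) (g : absgal i -> SL_group i n one_pts).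
Hypotheses (n_gt0 : (0 < n)%N) (Au : v.1 \in unitmx)
  (pE : map_poly i p = \prod_(l < n) ('X - (lam 0 l)%:P))
  (frm : eigenframe lam d Q Q' (pencil_op v) v)
  (hg : descent_choice v g).

Let T := pencil_op v.
Let pks := map_poly i p.
Let ev (u : {poly %/ pks}) := eval_mx T u.

Lemma ev_act (s : absgal i) (u : {poly %/ pks}) :
  ev (@qmap ks ks pks pks s u) = g s *m map_mx s (ev u) *m invmx (g s).
Proof.
apply: (eval_qmap (lam := lam) (lam' := lam)) => //.
  by rewrite mulVmx ?(descent_unit hg).
exact: pencil_op_act.
Qed.

Lemma res_mu2_mul (u w : {poly %/ pks}) :
  res_mu2 u -> res_mu2 w -> res_mu2 (u * w).
Proof. by rewrite /res_mu2 /= exprMn => -> ->; rewrite mulr1. Qed.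

(** The twisted action on matrices is multiplicative, and [ev] is injective. *)
Lemma qmapM (s : absgal i) (u w : {poly %/ pks}) :
  @qmap ks ks pks pks s (u * w) =
  @qmap ks ks pks pks s u * @qmap ks ks pks pks s w.
Proof.
apply: (eval_frame_inj frm n_gt0 pE); rewrite -/T -/(ev _) ev_act.
rewrite /ev !(eval_frameM frm n_gt0 pE) -!/(ev _) !ev_act map_mxM !mulmxA.
by rewrite mulmxKV ?(descent_unit hg).
Qed.

Lemma res_mu2_elementary : elementary (res_mu2_group i p).
Proof.
split=> /=.
- by [].
- by [].
- by move=> x y z ->.
- by move=> x x' y y' -> ->.
- exact: res_mu2_mul.
- move=> s u /(res_mu2_frame frm n_gt0 pE) uv.
  apply/(res_mu2_frame frm n_gt0 pE).
  by rewrite -/(ev _) ev_act; apply: act_fix.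
- exact: mulrA.
- by move=> x y _ _; apply: mulrC.
- by move=> x y y2; rewrite -mulrA -expr2 y2 mulr1.
- by [].
by move=> s x y _ _; apply: qmapM.
Qed.

Lemma res_mu2_N1_elementary : elementary (res_mu2_N1_group i p).
Proof.
have [? ? ? ? _ _ ? ? K _ A] := res_mu2_elementary; split=> //=.
- move=> x y /(res_mu2_N1_frame frm n_gt0 pE) xs.
  move=> /(res_mu2_N1_frame frm n_gt0 pE) ys.
  apply/(res_mu2_N1_frame frm n_gt0 pE); rewrite (eval_frameM frm n_gt0 pE).
  exact: stab_mul.
- move=> s u /(res_mu2_N1_frame frm n_gt0 pE) us.
  apply/(res_mu2_N1_frame frm n_gt0 pE).
  by rewrite -/(ev _) ev_act; apply: stab_act.
- by move=> x y _ _; apply: mulrC.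
- by move=> x y [y2 _]; apply: K.
by move=> s x y _ _; apply: qmapM.
Qed.

Lemma ev_morph :
  @galgroup_morph _ _ i (res_mu2_N1_group i p) (stab_group v g) ev.
Proof.
split=> /=.
- by move=> u /(res_mu2_N1_frame frm n_gt0 pE).
- by move=> u w ->; apply: (eqmod_refl one_pts_subfunctor).
- by move=> u w _ _; apply: (eval_frameM frm n_gt0 pE).
by move=> s u _; apply: ev_act.
Qed.

(* If E carries v to a pencil v0 fixed by Galois, then g_s s(E)^-1 E fixes v, *)
(* so it is ev u_s; its norm is s(b)/b for b = 1/det E, and its coboundary    *)
(* is that of g because the contributions of E cancel.                        *)
Lemma obstruction_lift (E : 'M[ks]_n) :
    E \in unitmx ->
    (forall s : absgal i, map_forms s (act_forms E v) = act_forms E v) ->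
  exists u : absgal i -> res_mu2_group i p,
    [/\ cochain1 u,
        forall s, qnorm (u s : {poly %/ pks}) = s (\det E)^-1 / (\det E)^-1 &
        forall s t, ev (coboundary u s t) =
          @coboundary _ _ i (SL_group i n one_pts) g s t].
Proof.
move=> Eu Efix; pose x := invmx E.
pose y (s : absgal i) := g s *m map_mx s x *m E.
have yv s : act_forms (y s) v = v.
  rewrite /y !act_formsM -(Efix s) -map_act_forms -act_formsM mulVmx //.
  by rewrite act_forms1; apply: hg.2.
have /choice[u uP] (s : absgal i) :
    exists u : {poly %/ pks}, res_mu2 u /\ ev u = y s.
  by have [u u2 uE] := fix_eval frm n_gt0 pE (yv s); exists u.
have um s : res_mu2 (u s) by case: (uP s).
have uE s : ev (u s) = y s by case: (uP s).
(* For [one_pts] equality modulo the center is plain equality. *)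
have geq X s : (forall s', gal_near X s' s -> gg_eq (g s') (g s)) ->
    forall s', gal_near X s' s -> g s' = g s.
  by move=> H s' /H[c -> ->]; rewrite scale1r.
exists u; split.
- split=> // s; have [X /geq gX] := hg.1.2 s.
  exists (X ++ [seq x a b | a <- enum 'I_n, b <- enum 'I_n]) => s' near /=.
  apply: (eval_frame_inj frm n_gt0 pE); rewrite -/T -!/(ev _) !uE /y.
  rewrite (gX s') => [|z zX]; last by apply: near; rewrite mem_cat zX.
  congr (_ *m _ *m _); apply/matrixP => a b; rewrite !mxE near // mem_cat.
  by apply/orP; right; apply/allpairsP; exists (a, b); rewrite !mem_enum.
- move=> s; rewrite (qnorm_frame frm n_gt0 pE) -/T -/(ev _) uE /y !det_mulmx.
  have -> : \det (g s) = 1 by exact: hg.1.1.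
  by rewrite det_map_mx det_inv mul1r invrK.
move=> s t; rewrite /coboundary /=.
rewrite /ev !(eval_frameM frm n_gt0 pE) -!/(ev _) ev_act !uE.
set st := gal_comp s t.
have yst : y st *m y st = 1%:M.
  rewrite -uE -(eval_frameM frm n_gt0 pE) -expr2 um.
  exact: (eval_frame1 frm).
have comm : y s *m (g s *m map_mx s (y t) *m invmx (g s)) =
    (g s *m map_mx s (y t) *m invmx (g s)) *m y s.
  rewrite -!uE -ev_act /ev -!(eval_frameM frm n_gt0 pE); congr (eval_mx _ _).
  by rewrite mulrC.
(* In this order g_s^-1 meets g_s and s(E) meets s(E)^-1, so the product telescopes. *)
rewrite comm.
have -> : (g s *m map_mx s (y t) *m invmx (g s)) *m y s =
    g s *m map_mx s (g t) *m invmx (g st) *m y st.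
  rewrite /y !map_mxM !mulmxA !mulmxKV ?(descent_unit hg) //.
  rewrite -(mulmxA _ (map_mx s E)) -map_mxM mulmxV // map_mx1 mulmx1.
  congr (_ *m _ *m _).
  by move: (x) => x'; apply/matrixP => a b; rewrite !mxE.
by rewrite -[LHS]mulmxA yst mulmx1.
Qed.

Variables (E : 'M[ks]_n) (f0 : k).
Hypotheses (Eu : E \in unitmx)
  (Efix : forall s : absgal i, map_forms s (act_forms E v) = act_forms E v)
  (detE : (\det E)^-1 ^+ 2 = i f0).

Lemma obstruction_delta0 :
  obstruction_class v g =
  H2map (res_mu2_N1_group i p) (stab_group v g) ev (delta0 i p f0).
Proof.
have [u [u1 uN uE]] := obstruction_lift Eu Efix.
have um s : res_mu2 (u s) := u1.1 s.
pose c0 : absgal i -> absgal i -> res_mu2_N1_group i p := coboundary u.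
have evc0 : (fun s t => ev (c0 s t)) =
    @coboundary _ _ i (SL_group i n one_pts) g.
  by apply/funext => s; apply/funext => t; apply: uE.
have eS := stab_group_elementary one_pts_subfunctor hg frm.
have eN := res_mu2_N1_elementary; have eR := res_mu2_elementary.
have [[cgm cgc] cgE] := coboundary_cocycle2 one_pts_subfunctor hg.
have c0m s t : res_mu2_N1 (c0 s t).
  by apply/(res_mu2_N1_frame frm n_gt0 pE); rewrite -/T -/(ev _) uE; apply: cgm.
have m1 : @res_mu2_N1 _ pks 1.
  apply/(res_mu2_N1_frame frm n_gt0 pE).
  by rewrite (eval_frame1 frm); split; [rewrite det1 | rewrite act_forms1].
have c0Z : cocycle2 c0.
  split; first split=> // s t.
    have [X Xc] := cgc s t; exists X => s' t' ns nt.
    apply: (eval_frame_inj frm n_gt0 pE); rewrite -/T -!/(ev _) !uE.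
    by have [c -> ->] := Xc s' t' ns nt; rewrite scale1r.
  move=> r s t; apply: (eval_frame_inj frm n_gt0 pE).
  rewrite -/T [LHS](eval_frameM frm n_gt0 pE) [RHS](eval_frameM frm n_gt0 pE).
  rewrite -!/(ev _) ev_act !uE.
  have [c cE1 cE] := cgE r s t. by apply: etrans cE _; rewrite cE1 scale1r.
rewrite eqEsubset; split=> c' [c'Z c'g]; split=> //.
  exists c0; last by rewrite evc0.
  exists (\det E)^-1 => //; exists u; split=> //; exists c0 => //.
  by split=> //; apply: cohomologous_refl eN _ _ m1.
move: c'g => [c [b b2 [u' [u1' uN' [c1 c1E [cZ cc1]]]]] c'c].
have um' s : res_mu2 (u' s) := u1'.1 s.
(* Both b and 1/det E are square roots of f_0, and the sign cancels in the quotient. *)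
have bE (s : absgal i) : s b / b = s (\det E)^-1 / (\det E)^-1.
  move/eqP: b2; rewrite -detE eqf_sqr => /orP[]/eqP-> //.
  by rewrite (rmorphN (gal_fun s)) invrN mulrNN.
(* Both lifts have norm s(b)/b, so their product has norm s(b^2)/b^2 = 1, as b^2 lies in k. *)
pose w (s : absgal i) : res_mu2_N1_group i p := u s * u' s.
have w1 : cochain1 w.
  have [wm wc] : cochain1 (w : absgal i -> res_mu2_group i p).
    exact: (cochain1M eR u1 u1').
  split=> // s; split; first exact: wm.
  rewrite (qnorm_frame frm n_gt0 pE) (eval_frameM frm n_gt0 pE) det_mulmx.
  rewrite -!(qnorm_frame frm n_gt0 pE) uN -[qnorm _]/(qnorm (u' s)) uN' -bE.
  rewrite mulrACA -rmorphM -invfM -expr2 b2 gal_fix divff //.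
  by rewrite -detE expf_neq0 // invr_eq0 -unitfE -unitmxE.
have c1w s t : c1 s t = c0 s t * coboundary w s t.
  have -> : coboundary w s t = c0 s t * coboundary u' s t.
    exact: (coboundaryM eR s t um um').
  have [c02 _] := c0m s t.
  by rewrite mulrA -expr2 c02 mul1r; apply: c1E.
have c1m s t : res_mu2_N1 (c1 s t).
  rewrite c1w; apply: (elem_memM eN) (c0m s t) _.
  exact: (coboundary_mem eN s t w1.1).
have c1c0 : cohomologous c1 c0 by exists w.
rewrite /obstruction_class.
apply: (cohomologous_trans eS) c'c _; rewrite -evc0.
apply: (cohomologous_trans eS) (morph_cohomologous eN eS ev_morph _ cc1) _.
  exact: c1m.
exact: (morph_cohomologous eN eS ev_morph).
Qed.

End ObstructionOfG.

(** * The obstruction class for H *)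

Section ObstructionOfH.
Variables (k ks : fieldType) (i : {rmorphism k -> ks}) (n : nat).
Variables (lam d : 'rV[ks]_n) (Q Q' T : 'M[ks]_n) (v : pair_forms n ks).
Variables (g : absgal i -> SL_group i n one_pts).
Variables (h : absgal i -> SL_group i n mu2_pts).
Hypotheses (frm : eigenframe lam d Q Q' T v)
  (hg : descent_choice v g) (hh : descent_choice v h).

Let gu s : g s \in unitmx := descent_unit hg s.
Let hu s : h s \in unitmx := descent_unit hh s.

Lemma descent_ratio_stab s : stab v (g s *m invmx (h s)).
Proof.
split; last by rewrite act_formsM (descent_actV hh) (descent_act hg).
have dg : \det (g s) = 1 by exact: hg.1.1.
have dh : \det (h s) = 1 by exact: hh.1.1.
by rewrite det_mulmx det_inv dg dh invr1 mulr1.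
Qed.

(* g_s and h_s differ by an element of stab v, which is abelian.              *)
Lemma twisted_act_eq s x : stab v x ->
  g s *m map_mx s x *m invmx (g s) = h s *m map_mx s x *m invmx (h s).
Proof.
move=> xs; have := stabC frm (descent_ratio_stab s) (stab_act hh s xs).
rewrite !mulmxA mulmxKV // => /(congr1 (fun y : 'M[ks]_n => y *m h s)).
by rewrite !mulmxKV // => ->; rewrite mulmxK.
Qed.

Lemma stab_id_morph :
  @galgroup_morph _ _ i (stab_group v g) (stab_group v h) (fun x => x).
Proof.
split=> //= [x y [c -> ->]|s x xs]; last exact: twisted_act_eq.
by rewrite scale1r; apply: (eqmod_refl mu2_pts_subfunctor).
Qed.

Lemma obstruction_cohomologous :
  @cohomologous _ _ i (stab_group v h)
    (@coboundary _ _ i (SL_group i n one_pts) g)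
    (@coboundary _ _ i (SL_group i n mu2_pts) h).
Proof.
pose e (s : absgal i) : stab_group v h := g s *m invmx (h s).
exists e.
  split=> s; first exact: descent_ratio_stab.
  have [X Xg] := hg.1.2 s; have [Y Yh] := hh.1.2 s; exists (X ++ Y) => s' near.
  apply: (eqmod_mulmx mu2_pts_subfunctor).
    have [|c -> ->] := Xg s'.
      by move=> z zX; apply: near; rewrite mem_cat zX.
    by rewrite scale1r; apply: (eqmod_refl mu2_pts_subfunctor).
  apply: (eqmod_invmx mu2_pts_subfunctor) => //; apply: Yh => z zY; apply: near.
  by rewrite mem_cat zY orbT.
move=> s t; have es r : stab v (e r) := descent_ratio_stab r.
set cg := coboundary _ _ _; set ch := coboundary _ _ _.
rewrite /coboundary /=; set F := e s *m _; set st := gal_comp s t.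
have Fs : stab v F by apply: stab_mul (es s) (stab_act hh s (es t)).
have chs : stab v ch := coboundary_stab hh s t.
(* Once [ch] is moved to the right of F, the h factors cancel and leave g_s s(g_t) h_st^-1. *)
have chF : ch *m F = cg *m e st.
  rewrite (stabC frm chs Fs) /F /e /cg /ch /coboundary /= !mulmxA.
  rewrite !mulmxKV // map_mxM map_invmx mulmxA -/st.
  by rewrite mulmxKV // map_unitmx.
have -> : ch *m (F *m invmx (e st)) = cg.
  by rewrite mulmxA chF mulmxK // unitmxE (es st).1 unitr1.
exact: (eqmod_refl mu2_pts_subfunctor).
Qed.

Lemma H2map_obstruction :
  H2map (stab_group v g) (stab_group v h) id (obstruction_class v g) =
  obstruction_class v h.
Proof.
have eG := stab_group_elementary one_pts_subfunctor hg frm.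
have eH := stab_group_elementary mu2_pts_subfunctor hh frm.
have cgh := obstruction_cohomologous.
have cgZ := coboundary_cocycle2 one_pts_subfunctor hg.
rewrite eqEsubset; split=> c' [c'Z c'c]; split=> //.
  case: c'c => c [cZ cg] c'c.
  apply: (cohomologous_trans eH) c'c _; apply: (cohomologous_trans eH) cgh.
  by apply: (morph_cohomologous eG eH stab_id_morph) cg; apply: cgZ.1.1.
exists (@coboundary _ _ i (SL_group i n one_pts) g).
  split=> //; apply: (@cohomologous_refl _ _ _ _ eG _ (1%:M : 'M[ks]_n)).
  by split; [rewrite det1 | rewrite act_forms1].
exact: (cohomologous_trans eH) c'c (cohomologous_sym eH cgh).
Qed.

End ObstructionOfH.

Theorem theorem4p4 (k ks : fieldType) (i : {rmorphism k -> ks})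
    (hks : separable_closure i) (char_k : 2%N \notin [pchar k])
    (n : nat) (n_gt0 : (0 < n)%N) (n_even : ~~ odd n)
    (f : 'I_n.+1 -> k) (D : k) (hD : is_discriminant f D) (D_neq0 : D != 0)
    (f0_neq0 : f ord0 != 0)
    (v : pair_forms n ks) (hv : V_ (fun j => i (f j)) v)
    (g : absgal i -> SL_group i n one_pts) (hg : descent_choice v g)
    (h : absgal i -> SL_group i n mu2_pts) (hh : descent_choice v h) :
  let T := pencil_op v in
  let dG := obstruction_class v g in
  let dH := obstruction_class v h in
  [/\ stab_scheme_iso v (monic_part f) g,
      stab_scheme_iso v (monic_part f) h,
      H2 (stab_group v g) dG,
      dG = H2map (res_mu2_N1_group i (monic_part f)) (stab_group v g)
             (fun u => eval_mx T u) (delta0 i (monic_part f) (f ord0)) &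
      H2 (stab_group v h) dH /\
      H2map (stab_group v g) (stab_group v h) id dG = dH].
Proof.
move=> T dG dH; have [_ kscl] := hks; have [sA sB _] := hv.
have if0 : i (f ord0) != 0 by rewrite fmorph_eq0.
have two0 : (2 : ks) != 0.
  rewrite -(rmorph_nat i) fmorph_eq0; apply: contra char_k => /eqP two0.
  by rewrite inE /= two0 eqxx.
have discA := form_disc_fst hv; rewrite /= in discA.
have A0 : \det v.1 != 0.
  by apply: contraNneq if0 => A0; rewrite -discA A0 mulr0.
have Au : v.1 \in unitmx by rewrite unitmxE unitfE.
have charT : char_poly T = map_poly i (monic_part f).
  rewrite (char_poly_pencil_op hv if0) /monic_part map_polyZ fmorphV.
  rewrite rmorph_sum /=; congr (_ *: _).
  by apply: eq_bigr => j _; rewrite map_polyZ /= map_polyXn.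
have [||rs rs_uniq rsE] := @separably_closed_split _ (char_poly T) kscl.
- exact: char_poly_monic.
- by rewrite charT separable_map (monic_part_separable hD).
have size_rs : size rs = n.
  by have := size_char_poly T; rewrite rsE size_prod_XsubC => -[].
pose lam : 'rV[ks]_n := \row_l rs`_l.
have lam_inj : injective (lam 0).
  move=> l m; rewrite !mxE => /eqP; rewrite nth_uniq ?size_rs // => /eqP.
  exact: val_inj.
have lamE : char_poly T = \prod_(l < n) ('X - (lam 0 l)%:P).
  rewrite rsE (big_nth 0) size_rs big_mkord.
  by apply: eq_bigr => l _; rewrite mxE.
have pE : map_poly i (monic_part f) = \prod_(l < n) ('X - (lam 0 l)%:P).
  by rewrite -charT.
(* The diagonal of A is prescribed as 1/g'(lam_l), so that the Vandermonde matrix then leads to the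
   trace-form pencil. *)
have [l|Q frm] :=
  exists_eigenframe kscl two0 sA sB Au lam_inj _
    (fun l => root_weight_neq0 l lam_inj).
  by rewrite -/T lamE rootE horner_prod (bigD1 l) //= hornerXsubC subrr mul0r.
have Wu := Vandermonde_unit lam_inj.
have Qu : Q \in unitmx := (mulmx1_unit (frame_inv frm)).1.
have Eu : Vandermonde n lam *m Q \in unitmx by rewrite unitmx_mul Wu.
have detE : (\det (Vandermonde n lam *m Q))^-1 ^+ 2 = i (f ord0).
  have E0 : \det (Vandermonde n lam *m Q) != 0 by rewrite -unitfE -unitmxE.
  apply: (mulfI (expf_neq0 2 E0)); rewrite -exprMn divff // expr1n -discA.
  by rewrite mulrCA (det_model lam_inj frm) -expr2 sqrr_sign.
split.
- exact: stab_scheme_isoP one_pts_subfunctor hg n_gt0 frm Au pE.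
- exact: stab_scheme_isoP mu2_pts_subfunctor hh n_gt0 frm Au pE.
- by exists (@coboundary _ _ i (SL_group i n one_pts) g) => //;
    exact: (coboundary_cocycle2 one_pts_subfunctor hg).
- apply: (obstruction_delta0 n_gt0 Au pE frm hg Eu _ detE) => s.
  exact: (gal_fix_model lam_inj pE frm).
split; first by exists (@coboundary _ _ i (SL_group i n mu2_pts) h) => //;
    exact: (coboundary_cocycle2 mu2_pts_subfunctor hh).
exact: (H2map_obstruction frm).
Qed.
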